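(* Let $d\ge 1$, $q\ge 2$, $M,B>0$ and $0<k<2$. For each $n$ let $\{y_1,\dots,y_n\}\subset[0,1)^d$ be an RQMC (randomized quasi-Monte Carlo) point set such that each $y_j\sim\mathcal U[0,1)^d$ and $$D_n^*(\{y_1,\dots,y_n\})\le C\,\frac{(\log n)^{d-1}}{n}\quad\text{a.s.},$$ where $C$ is a constant independent of $n$. Let $X$ be a $d$-dimensional standard normal random vector. Then, as $n\to\infty$, $$\sup_{f\in G_e(M,B,k)}\mathbb E\left[\left|\widehat I_n(f)-\mathbb E[f(X)]\right|^q\right]=\mathcal O\left(n^{-q}(\log n)^{q\left(\frac{3d}{2}-1\right)}\exp\left\{qM(4qd\log n)^{\frac k2}\right\}\right),$$ where the constant in the big-$\mathcal O$ bound depends on $M,B,k,d,q$.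
   Context: $\mathcal U[0,1)^d$ is the uniform distribution on $[0,1)^d$, and $D_n^*$ denotes the star discrepancy of an $n$-point set in $[0,1)^d$. An RQMC point set is a random point set in $[0,1)^d$; the only properties assumed here are those listed in the statement (the points are not assumed independent). $\Phi$ is the cumulative distribution function of the one-dimensional standard normal distribution; $\Phi^{-1}$ is its inverse, acting component-wise on vectors. For $f:\mathbb R^d\to\mathbb R$, $$\widehat I_n(f):=\frac1n\sum_{j=1}^n f\circ\Phi^{-1}(y_j).$$ Write $1:d=\{1,\dots,d\}$; for $u\subseteq 1:d$, $\partial^u f$ is the mixed partial derivative of $f$ taken once with respect to each $x_j$, $j\in u$ (with $\partial^\emptyset f=f$). $\mathcal S^d(\mathbb R^d)$ is the set of $f:\mathbb R^d\to\mathbb R$ such that $\partial^u f$ is continuous for every $u\subseteq 1:d$. For $M,B,k>0$, $$G_e(M,B,k):=\left\{f\in\mathcal S^d(\mathbb R^d):\ \sup_{u\subseteq 1:d}|\partial^u f(\boldsymbol x)|\le B e^{M|\boldsymbol x|^k}\ \text{for all }\boldsymbol x\in\mathbb R^d\right\},$$ where $|\boldsymbol x|$ is the Euclidean norm. *)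

(* Defs.v *)
From HB Require Import structures.
From mathcomp Require Import all_boot all_order all_algebra.
From mathcomp Require Import all_classical all_reals all_analysis.

Set Implicit Arguments.
Unset Strict Implicit.
Unset Printing Implicit Defensive.

Import Order.TTheory GRing.Theory Num.Theory.
Import numFieldNormedType.Exports.

Local Open Scope classical_set_scope.
Local Open Scope ring_scope.

(* The canonical norm of 'rV[R]_d is the max norm, hence this definition. *)
Definition euclidean_norm {R : realType} {d : nat} (x : 'rV[R]_d) : R :=
  Num.sqrt (\sum_(i < d) x ord0 i ^+ 2).

(* Iterated partial derivatives along a list of coordinates; the head of the
   list is the derivative taken last. *)
Fixpoint iter_partial {R : realType} {d : nat} (s : seq 'I_d)
    (f : 'rV[R]_d -> R) : 'rV[R]_d -> R :=
  if s is i :: s' then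
    fun x => derive (iter_partial s' f : _ -> R^o) x (delta_mx ord0 i)
  else f.

(* derive is a total function: existence has to be stated separately. *)
Fixpoint iter_derivable {R : realType} {d : nat} (s : seq 'I_d)
    (f : 'rV[R]_d -> R) : Prop :=
  if s is i :: s' then
    iter_derivable s' f /\
    forall x, derivable (iter_partial s' f : _ -> R^o) x (delta_mx ord0 i)
  else True.

(* enum u lists u in increasing order.  Fixing the order is harmless: in the
   class smooth_mixed all orders agree, by Schwarz's theorem. *)
Definition mixed_partial {R : realType} {d : nat} (u : {set 'I_d})
    (f : 'rV[R]_d -> R) : 'rV[R]_d -> R := iter_partial (enum u) f.

Definition smooth_mixed {R : realType} {d : nat} : set ('rV[R]_d -> R) :=
  [set f | forall u : {set 'I_d},
     iter_derivable (enum u) f /\ continuous (mixed_partial u f)].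

Definition growth_class {R : realType} {d : nat} (M B k : R) :
    set ('rV[R]_d -> R) :=
  [set f | smooth_mixed f /\
     forall x, \big[Num.max/0]_(u : {set 'I_d}) `|mixed_partial u f x|
               <= B * expR (M * euclidean_norm x `^ k)].

Definition normal_cdf {R : realType} (x : R) : R :=
  fine (normal_prob (0 : R) 1 `]-oo, x]).

(* normal_cdf is a bijection from R onto ]0, 1[; pinv inverts it there and takes
   the default value 0 elsewhere, in particular at 0. *)
Definition normal_quantile {R : realType} : R -> R := pinv setT normal_cdf.

Definition estimator {R : realType} {d n : nat} (f : 'rV[R]_d -> R)
    (y : 'I_n -> 'rV[R]_d) : R :=
  n%:R^-1 * \sum_(j < n) f (map_mx normal_quantile (y j)).

(* Points are counted with multiplicity. *)
Definition star_discrepancy {R : realType} {d n : nat}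
    (y : 'I_n -> 'rV[R]_d) : R :=
  sup [set `| #|[pred j : 'I_n | [forall i : 'I_d, y j ord0 i \in `[0, a ord0 i[]]|%:R
              / n%:R - \prod_(i < d) a ord0 i |
      | a in [set a : 'rV[R]_d | forall i, 0 <= a ord0 i <= 1]].

(* X is a random vector whose law is the d-fold product of mu, i.e. its
   coordinates are independent with law mu. *)
Definition has_product_law {R : realType} {d : nat} {dT : measure_display}
    {T : measurableType dT} (P : probability T R) (X : T -> 'rV[R]_d)
    (mu : set R -> \bar R) : Prop :=
  (forall i : 'I_d, measurable_fun [set: T] (fun w => X w ord0 i)) /\
  forall A : 'I_d -> set R, (forall i, measurable (A i)) ->
    P [set w | forall i, A i (X w ord0 i)] = (\prod_(i < d) mu (A i))%E.

Definition uniform_vector {R : realType} {d : nat} {dT : measure_display}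
    {T : measurableType dT} (P : probability T R) (Y : T -> 'rV[R]_d) : Prop :=
  has_product_law P Y (uniform_prob (@ltr01 R)).

Definition std_normal_vector {R : realType} {d : nat} {dT : measure_display}
    {T : measurableType dT} (P : probability T R) (X : T -> 'rV[R]_d) : Prop :=
  has_product_law P X (normal_prob (0 : R) 1).

Definition rqmc_points {R : realType} {d n : nat} {dT : measure_display}
    {T : measurableType dT} (P : probability T R) (C : R)
    (y : 'I_n -> T -> 'rV[R]_d) : Prop :=
  [/\ forall j w i, 0 <= y j w ord0 i < 1,
      forall j, uniform_vector P (y j) &
      {ae P, forall w, star_discrepancy (fun j => y j w)
                       <= C * (ln n%:R ^+ d.-1 / n%:R)}].

Definition moment_error {R : realType} {d n : nat} {dT dX : measure_display}
    {T : measurableType dT} {TX : measurableType dX}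
    (P : probability T R) (y : 'I_n -> T -> 'rV[R]_d)
    (PX : probability TX R) (X : TX -> 'rV[R]_d)
    (q : R) (f : 'rV[R]_d -> R) : \bar R :=
  'E_P[fun w => `|estimator f (fun j => y j w) - fine 'E_PX[f \o X]| `^ q].

(* Main.v *)
Require Import Defs.
From HB Require Import structures.
From mathcomp Require Import all_boot all_order all_algebra.
From mathcomp Require Import all_classical all_reals all_analysis.
From mathcomp Require Import measurable_realfun.
From mathcomp Require Import ring lra.
Import Order.TTheory GRing.Theory Num.Theory.
Import numFieldNormedType.Exports.
Local Open Scope classical_set_scope.
Local Open Scope ring_scope.
Set Implicit Arguments.
Unset Strict Implicit.

(** Fix the radius r with r^2 = 3 q ln n, divide [-r, r] into n cells and let G x
be the point x with every coordinate clipped to [-r, r] and rounded to a node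
of this grid ([grid_round]).  The integration error of f is at most that of
f o G plus the effect of replacing f by f o G in the estimator and in the
expectation.

The function f o G is a step function, and for it a Koksma-Hlawka inequality
needs no integral.  Abel summation in each coordinate writes f o G as a linear
combination of indicators of boxes prod_i ]-oo, t_i[ ([grid_expansion]).  The
coefficients are mixed differences of f over grid cells; one application of
the mean value theorem per differenced coordinate bounds them by the cell
volume times a bound of the mixed partial derivative ([mixed_diff_bound]).
Summed over all cells and all faces of the cube this gives the variation
B exp(M (sqrt d r)^k) (1 + 2 r)^d ([grid_box_combination]).  The quantile
transform turns the boxes into boxes anchored at 0 in the unit cube, so each
indicator is integrated up to the star discrepancy ([discrepancy_box],
[koksma_hlawka]).

Inside the cube |f - f o G| is at most d times the mesh 2 r / n times the same
exponential ([grid_round_close]).  Outside it, k < 2 makes |f| at most a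
constant times exp(z^2 / (12 q)), where z > r is the largest |x_i|; a factor
exp((z^2 - r^2) / (3 q)) >= 1 may be inserted, and exp(- r^2 / (3 q)) = 1 / n.
Hence the tail is at most K / n times the sum over i of
exp(5 x_i^2 / (12 q)) ([growth_tail]).  The q-th power of each summand is
integrable for the normal law because 5 / 12 < 1 / 2, and Jensen's inequality
([powR_mean_le]) transfers this to the average over the sample points.  Only
the one-dimensional marginals enter here, so dependence between the points is
harmless.

With L = ln n the three contributions are O(L^(3 d / 2 - 1) / n) times
exp(M (3 q d L)^(k / 2)), with a factor proportional to the discrepancy
constant C.  The claimed bound has 4 instead of 3 in the exponent; the
quotient of the two exponentials tends to infinity, so it absorbs C for large
n ([exponential_slack]), and the constant K does not depend on C. *)

(** * Mixed partial derivatives and mixed differences *)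

Definition coord_set {R : realType} {d : nat} (x : 'rV[R]_d) (i : 'I_d) (t : R) :
  'rV[R]_d := \row_j if j == i then t else x ord0 j.

Definition partial {R : realType} {d : nat} (i : 'I_d) (F : 'rV[R]_d -> R) :=
  iter_partial [:: i] F.

Lemma iter_partial_rcons (R : realType) (d : nat) (s : seq 'I_d) i
    (F : 'rV[R]_d -> R) :
  iter_partial (rcons s i) F = iter_partial s (partial i F).
Proof. by elim: s => //= j s ->. Qed.

Lemma iter_derivable_rcons (R : realType) (d : nat) (s : seq 'I_d) i
    (F : 'rV[R]_d -> R) :
  iter_derivable (rcons s i) F <->
  iter_derivable s (partial i F) /\
  forall x, derivable (F : _ -> R^o) x (delta_mx ord0 i).
Proof.
elim: s => [|j s [IH1 IH2]] /=; first by split=> -[].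
rewrite iter_partial_rcons; split.
  by move=> [/IH1[? ?] ?].
by move=> [[? ?] ?]; split => //; apply: IH2.
Qed.

(** Moving the i-th coordinate of a slice is moving along the i-th basis vector,
which is what identifies directional with one-variable derivatives. *)
Lemma coord_set_shift (R : realType) (d : nat) (x : 'rV[R]_d) i t h :
  coord_set x i (h *: 1 + t) = h *: delta_mx ord0 i + coord_set x i t.
Proof.
apply/rowP => j; rewrite !mxE eqxx /=; case: eqP => _ /=.
  by rewrite mulr1 scaler1.
by rewrite mulr0 add0r.
Qed.

Lemma coord_set_shift_neq (R : realType) (d : nat) (x : 'rV[R]_d) i j t h :
  i != j ->
  coord_set (h *: delta_mx ord0 i + x) j t =
  h *: delta_mx ord0 i + coord_set x j t.
Proof.
move=> ij; apply/rowP => l; rewrite !mxE eqxx /=.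
by case: (eqVneq l j) => // ->; rewrite eq_sym (negbTE ij) /= mulr0 add0r.
Qed.

Lemma is_derive_slice (R : realType) (d : nat) (F : 'rV[R]_d -> R) i x t :
  (forall x, derivable (F : _ -> R^o) x (delta_mx ord0 i)) ->
  is_derive t (1:R) (fun u => F (coord_set x i u) : R^o)
    (partial i F (coord_set x i t)).
Proof.
move=> dF; split.
  have := dF (coord_set x i t); rewrite /derivable.
  by under eq_fun => h do rewrite /= -(coord_set_shift x i t h).
rewrite /partial /= /derive.
by under [in RHS]eq_fun => h do rewrite /= -(coord_set_shift x i t h).
Qed.

Lemma is_derive_coord_set (R : realType) (d : nat) (F : 'rV[R]_d -> R) i j t x :
  i != j ->
  (forall x, derivable (F : _ -> R^o) x (delta_mx ord0 i)) ->
  is_derive x (delta_mx ord0 i) (fun y => F (coord_set y j t) : R^o)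
    (partial i F (coord_set x j t)).
Proof.
move=> ij dF; split.
  have := dF (coord_set x j t); rewrite /derivable.
  by under eq_fun => h do rewrite /= -(coord_set_shift_neq x t h ij).
rewrite /partial /= /derive.
by under [in RHS]eq_fun => h do rewrite /= -(coord_set_shift_neq x t h ij).
Qed.

Lemma slice_mean_value (R : realType) (d : nat) (F : 'rV[R]_d -> R) i x a b S :
  (forall x, derivable (F : _ -> R^o) x (delta_mx ord0 i)) -> a <= b ->
  (forall c, a <= c <= b -> `|partial i F (coord_set x i c)| <= S) ->
  `|F (coord_set x i b) - F (coord_set x i a)| <= S * (b - a).
Proof.
move=> dF ab bF.
pose f u : R := F (coord_set x i u).
have [|||c cab Hc] := @MVT_segment R f (fun u => partial i F (coord_set x i u)) a b.
- by [].
- by move=> u _; exact: is_derive_slice.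
- apply: derivable_within_continuous => u _.
  by have [] := is_derive_slice x u dF.
rewrite -/(f b) -/(f a) Hc normrM (ger0_norm (x := b - a)) ?subr_ge0//.
by rewrite ler_wpM2r ?subr_ge0// bF// -in_itv.
Qed.

Definition grid_node {R : realType} (r : R) (N a : nat) : R :=
  - r + 2 * r / N%:R * a%:R.

Definition grid_index {R : realType} (r : R) (N : nat) (x : R) : nat :=
  (\sum_(a < N) (grid_node r N a <= x)%R)%N.

Lemma grid_node0 (R : realType) (r : R) N : grid_node r N 0 = - r.
Proof. by rewrite /grid_node mulr0 addr0. Qed.

Lemma grid_nodeN (R : realType) (r : R) N : (0 < N)%N -> grid_node r N N = r.
Proof.
move=> N0; rewrite /grid_node divfK ?pnatr_eq0 -?lt0n//.
by rewrite mulr_natl mulr2n addrA addNr add0r.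
Qed.

Lemma grid_nodeS (R : realType) (r : R) N a :
  grid_node r N a.+1 = grid_node r N a + 2 * r / N%:R.
Proof. by rewrite /grid_node -[a.+1%:R]natr1 mulrDr mulr1 addrA. Qed.

Lemma grid_node_homo (R : realType) (r : R) N a b : 0 <= r -> (a <= b)%N ->
  grid_node r N a <= grid_node r N b.
Proof.
by move=> r0 ab; rewrite lerD2l ler_wpM2l ?ler_nat// divr_ge0// mulr_ge0.
Qed.

Lemma grid_node_bound (R : realType) (r : R) N a : 0 <= r -> (0 < N)%N ->
  (a <= N)%N -> `|grid_node r N a| <= r.
Proof.
move=> r0 N0 aN; rewrite ler_norml -{1}(grid_node0 r N) grid_node_homo//=.
by rewrite -[leRHS](grid_nodeN r N0) grid_node_homo.
Qed.

Lemma sum_thresholds_le (R : realType) (s : nat -> R) (N : nat) (x : R) :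
  (\sum_(a < N) (s a <= x)%R <= N)%N.
Proof.
rewrite -[X in (_ <= X)%N]card_ord -sum1_card; apply: leq_sum => i _.
exact: leq_b1.
Qed.

Lemma sum_thresholds_all (R : realType) (s : nat -> R) (N : nat) (x : R) :
  {homo s : a b / (a <= b)%N >-> a <= b} -> s N <= x ->
  (\sum_(a < N.+1) (s a <= x)%R)%N = N.+1.
Proof.
move=> hs sN; rewrite (eq_bigr (fun=> 1%N)) ?sum1_card ?card_ord// => i _.
by rewrite (le_trans _ sN)//; apply: hs; rewrite -ltnS.
Qed.

(** Abel summation: when the thresholds increase, those not exceeding x form an
initial segment, so the increments of phi beyond the count are exactly those
with x < s a. *)
Lemma telescope_thresholds (R : realType) (s : nat -> R) (phi : nat -> R)
    (N : nat) (x : R) : {homo s : a b / (a <= b)%N >-> a <= b} ->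
  phi (\sum_(a < N) (s a <= x)%R)%N =
  phi N - \sum_(a < N) (phi a.+1 - phi a) * (x < s a)%R%:R.
Proof.
move=> hs; elim: N => [|N IH]; first by rewrite !big_ord0 subr0.
case: (leP (s N) x) => sNx.
  rewrite sum_thresholds_all// big1 ?subr0// => i _.
  by rewrite ltNge (le_trans _ sNx) ?mulr0//; apply: hs; rewrite -ltnS.
rewrite !big_ord_recr /= leNgt sNx addn0 IH mulr1.
by rewrite opprD opprB addrCA [RHS]addrC; congr (_ + _); rewrite [RHS]addrC subrK.
Qed.

Lemma threshold_bracket (R : realType) (s : nat -> R) (N : nat) (x : R)
    (c := (\sum_(a < N) (s a <= x)%R)%N) :
  {homo s : a b / (a <= b)%N >-> a <= b} ->
  ((c < N)%N -> x < s c) /\ ((0 < c)%N -> s c.-1 <= x).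
Proof.
move=> hs; rewrite /c {c}; elim: N => [|N IH]; first by rewrite !big_ord0.
case: (leP (s N) x) => sNx.
  by rewrite sum_thresholds_all// ltnn.
rewrite !big_ord_recr /= leNgt sNx addn0.
split; last by case: IH.
have := sum_thresholds_le s N x; rewrite leq_eqVlt => /orP[/eqP ->//|h] _.
by case: IH => + _; apply.
Qed.

Lemma grid_index_le (R : realType) (r : R) N x : (grid_index r N x <= N)%N.
Proof. exact: sum_thresholds_le. Qed.

(** Every x in [-r, r] lies between the node it is rounded up to and the
previous one; the last node is r itself. *)
Lemma grid_index_close (R : realType) (r : R) N x : 0 <= r -> (0 < N)%N ->
  `|x| <= r -> `|x - grid_node r N (grid_index r N x)| <= 2 * r / N%:R.
Proof.
move=> r0 N0; rewrite ler_norml => /andP[rx xr].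
have h0 : 0 <= 2 * r / N%:R by rewrite divr_ge0// mulr_ge0.
have [] := @threshold_bracket _ (grid_node r N) N x.
  by move=> a b; exact: grid_node_homo.
rewrite -/(grid_index r N x); move: (grid_index_le r N x).
case E : (grid_index r N x) => [|c] cN.
  by move=> /(_ N0); rewrite grid_node0 => xlt; lra.
move=> /= lo /(_ isT) up; have xle : x <= grid_node r N c.+1.
  move: cN; rewrite leq_eqVlt => /orP[/eqP ->|/lo/ltW//].
  by rewrite grid_nodeN.
by rewrite ler_norml; move: xle; rewrite grid_nodeS => xle; lra.
Qed.

(** For a < N this is the increment over the a-th cell; the default branch,
a >= N, freezes the coordinate at the right end r.  A multi-index thus encodes
both a face of the cube, through the frozen coordinates, and a cell in it. *)
Definition grid_step {R : realType} {d : nat} (r : R) (N : nat) (i : 'I_d) (a : nat)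
    (F : 'rV[R]_d -> R) (x : 'rV[R]_d) : R :=
  if (a < N)%N then
    F (coord_set x i (grid_node r N a.+1)) - F (coord_set x i (grid_node r N a))
  else F (coord_set x i r).

(** The head of s is differenced first, so that the mean value theorem, applied
to the outermost difference, produces the derivatives in the order of
[iter_partial], where the head is taken last. *)
Definition mixed_diff {R : realType} {d : nat} (r : R) (N : nat) (s : seq 'I_d)
    (b : 'I_d -> nat) (F : 'rV[R]_d -> R) : 'rV[R]_d -> R :=
  foldl (fun F i => grid_step r N i (b i) F) F s.

Lemma partial_grid_step (R : realType) (d : nat) (r : R) N i j a
    (F : 'rV[R]_d -> R) :
  i != j -> (forall x, derivable (F : _ -> R^o) x (delta_mx ord0 i)) ->
  (forall x, derivable (grid_step r N j a F : _ -> R^o) x (delta_mx ord0 i)) /\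
  partial i (grid_step r N j a F) = grid_step r N j a (partial i F).
Proof.
move=> ij dF; have H x : is_derive x (delta_mx ord0 i)
    (grid_step r N j a F : _ -> R^o) (grid_step r N j a (partial i F) x).
  rewrite /grid_step; case: ifP => aN; last exact: is_derive_coord_set.
  by apply: is_deriveB; exact: is_derive_coord_set.
split=> [x|]; first by case: (H x).
by apply/funext => x; case: (H x).
Qed.

(** Differences in other coordinates commute with a partial derivative: they are
linear combinations of values along parallel slices. *)
Lemma partial_mixed_diff (R : realType) (d : nat) (r : R) N i s b
    (F : 'rV[R]_d -> R) :
  i \notin s -> (forall x, derivable (F : _ -> R^o) x (delta_mx ord0 i)) ->
  (forall x, derivable (mixed_diff r N s b F : _ -> R^o) x (delta_mx ord0 i)) /\
  partial i (mixed_diff r N s b F) = mixed_diff r N s b (partial i F).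
Proof.
elim: s F => [//|j s IH] F; rewrite inE negb_or => /andP[ij is_] dF.
have [dF' pF] := partial_grid_step r N (b j) ij dF.
by have [? /= ->] := IH _ is_ dF'; rewrite pF.
Qed.

Lemma coord_set_bound (R : realType) (d : nat) (x : 'rV[R]_d) i t (r : R) :
  (forall j, `|x ord0 j| <= r) -> `|t| <= r ->
  forall j, `|coord_set x i t ord0 j| <= r.
Proof. by move=> xr tr j; rewrite mxE; case: ifP. Qed.

(** The outermost difference is, by the mean value theorem, the mesh times a
partial derivative, which commutes with the remaining differences; induction
peels off one coordinate at a time. *)
Lemma mixed_diff_bound (R : realType) (d : nat) (r : R) N s b
    (F : 'rV[R]_d -> R) (S : R) (x : 'rV[R]_d) (u := [seq i <- s | (b i < N)%N]) :
  0 <= r -> (0 < N)%N -> uniq s -> iter_derivable u F ->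
  (forall z : 'rV[R]_d, (forall i, `|z ord0 i| <= r) -> `|iter_partial u F z| <= S) ->
  (forall i, `|x ord0 i| <= r) ->
  `|mixed_diff r N s b F x| <= S * (2 * r / N%:R) ^+ size u.
Proof.
move=> r0 N0; rewrite /u {u}.
elim/last_ind: s F x => [|s i IH] F x; first by rewrite /= mulr1 => _ _; exact.
rewrite rcons_uniq filter_rcons /mixed_diff foldl_rcons /grid_step => /andP[is_ us].
case: ifP => biN; last first.
  by move=> dF bF xr; apply: IH => //; apply: coord_set_bound; rewrite ?ger0_norm.
rewrite iter_derivable_rcons iter_partial_rcons size_rcons => -[dF dFi] bF xr.
rewrite -/(mixed_diff r N s b F).
have [dG pG] := partial_mixed_diff r N b is_ dFi.
rewrite exprSr mulrA -[X in _ * _ * X](_ : grid_node r N (b i).+1 - grid_node r N (b i) = _); last first.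
  by rewrite grid_nodeS addrAC subrr add0r.
apply: slice_mean_value => //; first by rewrite grid_node_homo.
move=> c /andP[ac cb]; rewrite pG; apply: IH => //; apply: coord_set_bound => //.
have := grid_node_bound r0 N0 (ltnW biN); have := grid_node_bound r0 N0 biN.
by rewrite !ler_norml; lra.
Qed.

(** * Rounding to a grid as a combination of box indicators *)

Lemma eq_mixed_diff (R : realType) (d : nat) (r : R) N (s : seq 'I_d) b b'
    (F : 'rV[R]_d -> R) : {in s, b =1 b'} ->
  mixed_diff r N s b F = mixed_diff r N s b' F.
Proof.
elim: s F => [//|i s IH] F bb'; rewrite /mixed_diff /= bb' ?mem_head//.
by apply: IH => j js; apply: bb'; rewrite inE js orbT.
Qed.

(** None stands for a coordinate on which a box imposes nothing; it comes from a
coordinate frozen at the right end of the cube. *)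
Definition ray_indic {R : realType} (o : option R) (x : R) : R :=
  if o is Some t then (x < t)%R%:R else 1.

Definition box_indic {R : realType} {d : nat} (A : {ffun 'I_d -> option R})
  (x : 'rV[R]_d) : R := \prod_(i < d) ray_indic (A i) (x ord0 i).

(** A substitute for bounded variation in the sense of Hardy and Krause: V
bounds the total mass of the coefficients. *)
Definition box_combination {R : realType} {d : nat} (V : R)
    (phi : 'rV[R]_d -> R) : Prop :=
  exists l : seq (R * {ffun 'I_d -> option R}),
    \sum_(p <- l) `|p.1| <= V /\
    phi = fun x => \sum_(p <- l) p.1 * box_indic p.2 x.

Lemma box_combinationD (R : realType) (d : nat) (V W : R)
    (phi psi : 'rV[R]_d -> R) : box_combination V phi -> box_combination W psi ->
  box_combination (V + W) (fun x => phi x + psi x).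
Proof.
move=> [l [lV ->]] [m [mW ->]]; exists (l ++ m); split.
  by rewrite big_cat lerD.
by apply/funext => x; rewrite big_cat.
Qed.

Lemma box_combinationN (R : realType) (d : nat) (V : R)
    (phi : 'rV[R]_d -> R) : box_combination V phi ->
  box_combination V (fun x => - phi x).
Proof.
move=> [l [lV ->]]; exists [seq (- p.1, p.2) | p <- l]; split.
  by rewrite big_map; under eq_bigr do rewrite normrN.
by apply/funext => x; rewrite big_map -sumrN; apply: eq_bigr => p _; rewrite mulNr.
Qed.

Lemma box_combination_sum (R : realType) (d N : nat) (V : R)
    (phi : nat -> 'rV[R]_d -> R) :
  (forall a, (a < N)%N -> box_combination V (phi a)) ->
  box_combination (N%:R * V) (fun x => \sum_(a < N) phi a x).
Proof.
elim: N => [|N IH] H.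
  exists [::]; rewrite !big_nil mul0r lexx; split => //.
  by apply/funext => x; rewrite big_ord0 big_nil.
rewrite -natr1 mulrDl mul1r.
have -> : (fun x => \sum_(a < N.+1) phi a x) =
  fun x => \sum_(a < N) phi a x + phi N x.
  by apply/funext => x; rewrite big_ord_recr.
apply: box_combinationD; last exact: H.
by apply: IH => a aN; apply: H; rewrite (ltn_trans aN).
Qed.

(** Coordinates outside s are replaced by the base point 0, so that the
expansion can proceed one coordinate at a time. *)
Definition grid_round {R : realType} {d : nat} (r : R) (N : nat) (s : seq 'I_d)
    (x : 'rV[R]_d) : 'rV[R]_d :=
  \row_i if i \in s then grid_node r N (grid_index r N (x ord0 i)) else 0.

Definition restrict_box {R : realType} {d : nat} (A : {ffun 'I_d -> option R}) i t :=
  [ffun j => if j == i then Some t else A j].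

Lemma box_indic_restrict (R : realType) (d : nat) (A : {ffun 'I_d -> option R}) i t
    (x : 'rV[R]_d) : A i = None ->
  box_indic (restrict_box A i t) x = (x ord0 i < t)%R%:R * box_indic A x.
Proof.
move=> Ai; rewrite /box_indic (bigD1 i)//= [in RHS](bigD1 i)//= Ai mul1r ffunE eqxx.
by congr (_ * _); apply: eq_bigr => j /negbTE ji; rewrite ffunE ji.
Qed.

(** One step of the expansion: Abel summation in the coordinate i. *)
Lemma grid_round_cons (R : realType) (d : nat) (r : R) (N : nat) i s
    (F : 'rV[R]_d -> R) x : 0 <= r -> (0 < N)%N -> i \notin s ->
  F (grid_round r N (i :: s) x) =
  grid_step r N i N F (grid_round r N s x) -
  \sum_(a < N) grid_step r N i a F (grid_round r N s x) *
    (x ord0 i < grid_node r N a)%R%:R.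
Proof.
move=> r0 N0 is_.
pose phi a := F (coord_set (grid_round r N s x) i (grid_node r N a)).
transitivity (phi (grid_index r N (x ord0 i))).
  congr F; apply/rowP => j; rewrite !mxE in_cons.
  by case: eqP => [->|].
rewrite /grid_index telescope_thresholds; last first.
  by move=> a b; exact: grid_node_homo.
rewrite /phi grid_nodeN// /grid_step ltnn; congr (_ - _).
by apply: eq_bigr => a _; rewrite ltn_ord.
Qed.

(** Each coordinate contributes a factor 1 + N h: the term 1 comes from freezing
it at the right end, N h from the N cells.  The box A accumulates the rays of
the coordinates expanded so far. *)
Lemma grid_expansion (R : realType) (d : nat) (r : R) (N : nat) s
    (F : 'rV[R]_d -> R) (S : R) (A : {ffun 'I_d -> option R}) (h := 2 * r / N%:R) :
  0 <= r -> (0 < N)%N -> uniq s -> (forall i, i \in s -> A i = None) ->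
  (forall b, `|mixed_diff r N s b F 0| <=
     S * h ^+ size [seq i <- s | (b i < N)%N]) ->
  box_combination (S * (1 + N%:R * h) ^+ size s)
    (fun x => F (grid_round r N s x) * box_indic A x).
Proof.
move=> r0 N0.
elim: s F S A => [|i s IH] F S A; rewrite ?cons_uniq.
  move=> _ _ /(_ (fun=> 0%N)) /= H; exists [:: (F 0, A)].
  rewrite big_seq1/=; split=> //; apply/funext => x; rewrite big_seq1.
  by congr (F _ * _); apply/rowP => j; rewrite !mxE.
move=> /andP[is_ us] As bF.
have As' j : j \in s -> A j = None by move=> js; apply: As; rewrite inE js orbT.
have -> : (fun x => F (grid_round r N (i :: s) x) * box_indic A x) =
  fun x => grid_step r N i N F (grid_round r N s x) * box_indic A x +
   - \sum_(a < N) grid_step r N i a F (grid_round r N s x) *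
      box_indic (restrict_box A i (grid_node r N a)) x.
  apply/funext => x; rewrite grid_round_cons// mulrBl mulr_suml; congr (_ - _).
  apply: eq_bigr => a _; rewrite box_indic_restrict ?mulrA//.
  by apply: As; rewrite inE eqxx.
have -> : S * (1 + N%:R * h) ^+ size (i :: s) = S * (1 + N%:R * h) ^+ size s +
   N%:R * (S * h * (1 + N%:R * h) ^+ size s) by rewrite /= exprS; ring.
have key (a : nat) b : `|mixed_diff r N s b (grid_step r N i a F) 0| <=
     (if (a < N)%N then S * h else S) * h ^+ size [seq i <- s | (b i < N)%N].
  have /= := bF (fun j => if j == i then a else b j).
  rewrite eqxx; rewrite (_ : [seq j <- s | _] = [seq j <- s | (b j < N)%N]); last first.
    by apply: eq_in_filter => j js; case: eqP is_ => // <-; rewrite js.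
  rewrite (_ : mixed_diff _ _ _ _ _ = mixed_diff r N s b (grid_step r N i a F)).
    by case: ifP => _ //=; rewrite exprS mulrA.
  apply: eq_mixed_diff => j js.
  by case: eqP is_ => // <-; rewrite js.
apply: box_combinationD.
  by apply: IH => // b; have := key N b; rewrite ltnn.
apply: box_combinationN; apply: (@box_combination_sum _ _ N _ (fun a x =>
  grid_step r N i a F (grid_round r N s x) *
  box_indic (restrict_box A i (grid_node r N a)) x)) => a aN.
apply: IH => // [j js|b].
  rewrite ffunE; case: eqP is_ => [<-|_ _]; first by rewrite js.
  exact: As'.
by have := key a b; rewrite aN.
Qed.

(** The bound of the growth class at the corners of the cube of half-width r. *)
Definition cube_growth {R : realType} (d : nat) (M B k r : R) : R :=
  B * expR (M * (Num.sqrt d%:R * r) `^ k).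

Lemma euclidean_norm_cube (R : realType) (d : nat) (r : R) (z : 'rV[R]_d) :
  0 <= r -> (forall i, `|z ord0 i| <= r) ->
  euclidean_norm z <= Num.sqrt d%:R * r.
Proof.
move=> r0 zr; have -> : Num.sqrt d%:R * r = Num.sqrt (d%:R * r ^+ 2).
  by rewrite sqrtrM ?ler0n// sqrtr_sqr ger0_norm.
rewrite /euclidean_norm ler_wsqrtr// -[d in leRHS]card_ord mulr_natl -sumr_const ler_sum// => i _.
by rewrite -[_ ^+ 2]ger0_norm ?sqr_ge0// normrX lerXn2r// nnegrE.
Qed.

Lemma growth_class_bound (R : realType) (d : nat) (M B k r : R) f u (z : 'rV[R]_d) :
  0 < M -> 0 < B -> 0 < k -> 0 <= r -> growth_class M B k f ->
  (forall i, `|z ord0 i| <= r) -> `|mixed_partial u f z| <= cube_growth d M B k r.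
Proof.
move=> M0 B0 k0 r0 [_ fg] zr.
apply: (@le_trans _ _ (B * expR (M * euclidean_norm z `^ k))).
  by apply: le_trans (fg z); exact: (le_bigmax _ (fun u => `|mixed_partial u f z|)).
rewrite /cube_growth ler_pM2l// ler_expR ler_pM2l// ge0_ler_powR ?nnegrE ?(ltW k0)//.
- by rewrite sqrtr_ge0.
- by rewrite mulr_ge0// sqrtr_ge0.
- exact: euclidean_norm_cube.
Qed.

Lemma filter_enum_ord (d : nat) (p : pred 'I_d) :
  [seq i <- enum 'I_d | p i] = enum [set i | p i]%SET.
Proof.
by rewrite /enum_mem -filter_predI; apply: eq_filter => i; rewrite /= !inE andbT.
Qed.

Lemma grid_box_combination (R : realType) (d : nat) (M B k r : R) N
    (f : 'rV[R]_d -> R) :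
  0 < M -> 0 < B -> 0 < k -> 0 <= r -> (0 < N)%N -> growth_class M B k f ->
  box_combination (cube_growth d M B k r * (1 + 2 * r) ^+ d)
    (fun x => f (grid_round r N (enum 'I_d) x)).
Proof.
move=> M0 B0 k0 r0 N0 fG.
have := @grid_expansion _ d r N (enum 'I_d) f (cube_growth d M B k r)
  [ffun=> None] r0 N0 (enum_uniq _).
rewrite (_ : N%:R * (2 * r / N%:R) = 2 * r); last first.
  by rewrite mulrC divfK// pnatr_eq0 -lt0n.
rewrite size_enum_ord.
rewrite (_ : (fun x => _) = (fun x => f (grid_round r N (enum 'I_d) x))); last first.
  apply/funext => x; rewrite /box_indic big1 ?mulr1// => i _.
  by rewrite ffunE.
apply; first by move=> i _; rewrite ffunE.
move=> b; have [fs _] := fG.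
have [di _] := fs [set i : 'I_d | (b i < N)%N]%SET.
apply: mixed_diff_bound => //; rewrite ?enum_uniq ?filter_enum_ord//.
- by move=> z zr; exact: growth_class_bound.
- by move=> i; rewrite mxE normr0.
Qed.

(** * The rounding error inside a cube *)

Lemma slice_lipschitz (R : realType) (d : nat) (F : 'rV[R]_d -> R) i (x : 'rV[R]_d) (a b r S : R) :
  (forall x, derivable (F : _ -> R^o) x (delta_mx ord0 i)) ->
  (forall j, `|x ord0 j| <= r) -> `|a| <= r -> `|b| <= r ->
  (forall z : 'rV[R]_d, (forall j, `|z ord0 j| <= r) -> `|partial i F z| <= S) ->
  `|F (coord_set x i a) - F (coord_set x i b)| <= S * `|a - b|.
Proof.
move=> dF xr ar br bF.
wlog ba : a b ar br / b <= a.
  move=> H; case: (leP b a) => [|/ltW] ba; first exact: H.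
  by rewrite distrC (distrC a); exact: H.
rewrite (ger0_norm (x := a - b)) ?subr_ge0//.
apply: slice_mean_value => // c /andP[ac cb]; apply/bF/coord_set_bound => //.
by move: ar br; rewrite !ler_norml; lra.
Qed.

(** Round one coordinate at a time and apply the mean value theorem; first-order
partial derivatives are mixed ones for singletons. *)
Lemma grid_round_close (R : realType) (d : nat) (M B k r : R) N
    (f : 'rV[R]_d -> R) (x : 'rV[R]_d) :
  0 < M -> 0 < B -> 0 < k -> 0 <= r -> (0 < N)%N -> growth_class M B k f ->
  (forall i, `|x ord0 i| <= r) ->
  `|f x - f (grid_round r N (enum 'I_d) x)| <=
  d%:R * (2 * r / N%:R) * cube_growth d M B k r.
Proof.
move=> M0 B0 k0 r0 N0 fG xr.
pose g i := grid_node r N (grid_index r N (x ord0 i)).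
have gr i : `|g i| <= r by apply: grid_node_bound => //; exact: grid_index_le.
(* Only the coordinates in s are rounded. *)
pose hyb (s : seq 'I_d) : 'rV[R]_d := \row_i if i \in s then g i else x ord0 i.
have hr s i : `|hyb s ord0 i| <= r by rewrite mxE; case: ifP.
have -> : grid_round r N (enum 'I_d) x = hyb (enum 'I_d).
  by apply/rowP => i; rewrite !mxE mem_enum.
have S0 : 0 <= cube_growth d M B k r.
  by rewrite mulr_ge0 ?expR_ge0// ltW.
rewrite -[X in X%:R]size_enum_ord.
elim: (enum 'I_d) => [|i s IH].
  rewrite (_ : hyb [::] = x) ?subrr ?normr0 ?mul0r//.
  by apply/rowP => i; rewrite !mxE.
have [is_|is_] := boolP (i \in s).
  rewrite (_ : hyb (i :: s) = hyb s); last first.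
    by apply/rowP => j; rewrite !mxE inE; case: eqP => // ->; rewrite is_.
  apply: le_trans IH _; rewrite ler_wpM2r// ler_wpM2r ?ler_nat//.
  by rewrite divr_ge0// mulr_ge0.
rewrite -(subrKA (f (hyb s))) (le_trans (ler_normD _ _))//=.
rewrite mulrSr mulrDl mul1r mulrDl lerD//.
have {1}-> : hyb s = coord_set (hyb s) i (x ord0 i).
  by apply/rowP => j; rewrite !mxE; case: eqP => // ->; rewrite (negbTE is_).
have -> : hyb (i :: s) = coord_set (hyb s) i (g i).
  by apply/rowP => j; rewrite !mxE inE; case: eqP => // ->.
have [fs _] := fG; have [] := fs [set i]%SET.
rewrite /mixed_partial enum_set1 => -[_ dF] _.
apply: (@le_trans _ _ (cube_growth d M B k r * `|x ord0 i - g i|)).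
  apply: (@slice_lipschitz _ _ _ _ _ _ _ r) => // z zr.
  have := growth_class_bound [set i]%SET M0 B0 k0 r0 fG zr.
  by rewrite /mixed_partial enum_set1.
by rewrite mulrC ler_wpM2r// grid_index_close.
Qed.

(** * The normal distribution function and its quantile *)

Lemma normal_prob_fin (R : realType) (A : set R) : measurable A ->
  (fine (normal_prob (0 : R) 1 A))%:E = normal_prob (0 : R) 1 A.
Proof. by move=> mA; rewrite fineK// fin_num_measure. Qed.

Lemma normal_cdf_diff (R : realType) (a b : R) : a <= b ->
  (normal_cdf b - normal_cdf a)%:E = normal_prob (0 : R) 1 `]a, b].
Proof.
move=> ab; rewrite EFinB /normal_cdf !normal_prob_fin//.
have -> : `]-oo, b]%classic = `]-oo, a] `|` `]a, b]%classic.
  by rewrite -itv_bndbnd_setU// bnd_simp.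
rewrite measureU//=.
  by rewrite addeAC subee ?add0e// fin_num_measure.
apply/seteqP; split => // x [] /=; rewrite !in_itv/= => xa /andP[ax _].
by move: xa; rewrite leNgt ax.
Qed.

(** The density is bounded by its peak; this gives a Lipschitz bound for the
distribution function. *)
Lemma normal_prob_itv_le (R : realType) (a b : R) : a <= b ->
  (normal_prob (0 : R) 1 `]a, b] <= (normal_peak 1 * (b - a))%:E)%E.
Proof.
move=> ab; rewrite /normal_prob.
apply: (@le_trans _ _ (\int[lebesgue_measure]_(x in `]a, b]) (normal_peak (1 : R))%:E)%E).
  apply: ge0_le_integral => //=.
  - by move=> x _; rewrite lee_fin normal_pdf_ge0.
  - apply/measurable_EFinP; apply: measurable_funTS; exact: measurable_normal_pdf.
  - by move=> x _; rewrite lee_fin normal_pdf_ub// oner_eq0.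
rewrite integral_cst//= lebesgue_measure_itv/= lte_fin.
move: ab; rewrite le_eqVlt => /predU1P[->|->]; last by rewrite -EFinD EFinM.
by rewrite ltxx mule0 subrr mulr0.
Qed.

(** The density is positive, which makes the distribution function injective and
its quantile a true inverse. *)
Lemma normal_prob_itv_gt0 (R : realType) (a b : R) : a < b ->
  (0 < normal_prob (0 : R) 1 `]a, b])%E.
Proof.
move=> ab; rewrite /normal_prob.
set c : R := normal_peak 1 * expR (- (a ^+ 2 + b ^+ 2) / 2).
have c0 : 0 < c by rewrite mulr_gt0 ?expR_gt0// normal_peak_gt0 ?oner_eq0.
apply: (@lt_le_trans _ _ (\int[lebesgue_measure]_(x in `]a, b]) c%:E)%E).
  rewrite integral_cst//= lebesgue_measure_itv/= lte_fin ab -EFinD.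
  by rewrite -EFinM lte_fin mulr_gt0// subr_gt0.
apply: ge0_le_integral => //=.
- by move=> x _; rewrite lee_fin ltW.
- apply/measurable_EFinP; apply: measurable_funTS; exact: measurable_normal_pdf.
- move=> x /=; rewrite in_itv/= => /andP[ax xb]; rewrite lee_fin.
  rewrite normal_pdfE ?oner_eq0// /c ler_pM2l ?normal_peak_gt0 ?oner_eq0//.
  rewrite /normal_fun ler_expR subr0 expr1n ler_pM2r ?invr_gt0// lerN2.
  case: (leP 0 x) => x0; [have := sqr_ge0 a|have := sqr_ge0 b]; nra.
Qed.

Lemma normal_cdf_lt (R : realType) (a b : R) :
  (normal_cdf a < normal_cdf b) = (a < b).
Proof.
have lt x y : x < y -> normal_cdf x < normal_cdf y :> R.
  by move=> xy; rewrite -subr_gt0 -lte_fin normal_cdf_diff ?normal_prob_itv_gt0 ?ltW.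
case: (ltgtP a b) => [/lt ->//|/lt/ltW|->]; last by rewrite ltxx.
by rewrite leNgt => /negbTE.
Qed.

Lemma normal_cdf_continuous (R : realType) : continuous (@normal_cdf R).
Proof.
move=> x; apply/cvgrPdist_le => e e0.
pose K : R := normal_peak 1; have K0 : 0 < K by rewrite normal_peak_gt0 ?oner_eq0.
have lip a b : `|normal_cdf a - normal_cdf b| <= K * `|a - b| :> R.
  wlog ba : a b / b <= a.
    by move=> H; case: (leP b a) => [|/ltW] ba; [exact: H|rewrite distrC (distrC a) H].
  rewrite ger0_norm ?(ger0_norm (x := a - b)) ?subr_ge0//.
    by rewrite -lee_fin normal_cdf_diff// normal_prob_itv_le.
  by rewrite leNgt normal_cdf_lt -leNgt.
near=> t; apply: le_trans (lip _ _) _.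
rewrite mulrC -ler_pdivlMr//; near: t.
by apply: (@cvgr_dist_le _ _ _ (nbhs x) _ id); [exact: cvg_id|rewrite divr_gt0].
Unshelve. all: by end_near. Qed.


(** The normal law is the law of the identity, so the limits at infinity of the
distribution function of a random variable apply to it. *)
Definition real_id {R : realType} : measurableTypeR R -> R := idfun.

HB.instance Definition _ (R : realType) :=
  @isMeasurableFun.Build _ _ _ _ (@real_id R) (@measurable_id _ _ setT).

Lemma normal_cdf_surj (R : realType) (y : R) : 0 < y < 1 ->
  exists x, normal_cdf x = y.
Proof.
move=> /andP[y0 y1].
pose X : {RV normal_prob (0 : R) 1 >-> R} := real_id.
have cdfX : fine \o cdf X = @normal_cdf R.
  by apply/funext => x; rewrite /cdf/= /distribution /pushforward /= /normal_cdf.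
have cdfy : normal_cdf x @[x --> +oo] --> (1 : R).
  by rewrite -cdfX; apply: (@fine_cvg _ _ _ _ (cdf X) 1); exact: cvg_cdfy1.
have cdfNy : normal_cdf x @[x --> -oo] --> (0 : R).
  by rewrite -cdfX; apply: (@fine_cvg _ _ _ _ (cdf X) 0); exact: cvg_cdfNy0.
have [b yb] := @filter_ex _ _ _ _ (cvgr_gt _ cdfy _ y1).
have [a ya] := @filter_ex _ _ _ _ (cvgr_lt _ cdfNy _ y0).
have ab : normal_cdf a <= normal_cdf b by rewrite ltW// (lt_trans ya).
have [|||x _ xy] := @IVT R (@normal_cdf R) a b y.
- by rewrite leNgt -normal_cdf_lt -leNgt.
- by apply: continuous_subspaceT => x; exact: normal_cdf_continuous.
- by rewrite (min_l ab) (max_r ab) !ltW.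
by exists x.
Qed.

Lemma normal_cdf_quantile (R : realType) (y : R) : 0 < y < 1 ->
  normal_cdf (normal_quantile y) = y.
Proof.
move=> /normal_cdf_surj[x <-]; rewrite /normal_quantile.
by apply: pinvK; rewrite inE; exists x.
Qed.

(** The quantile transform exchanges rays: this carries boxes of the sample
points in the unit cube to boxes of their normal images. *)
Lemma normal_quantile_lt (R : realType) (y t : R) : 0 < y < 1 ->
  (normal_quantile y < t) = (y < normal_cdf t).
Proof. by move=> y01; rewrite -normal_cdf_lt normal_cdf_quantile. Qed.

Lemma normal_cdf01 (R : realType) (t : R) : 0 < normal_cdf t < 1.
Proof.
apply/andP; split.
  apply: (@le_lt_trans _ _ (normal_cdf (t - 1))); first by rewrite fine_ge0.
  by rewrite normal_cdf_lt; lra.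
apply: (@lt_le_trans _ _ (normal_cdf (t + 1))); first by rewrite normal_cdf_lt; lra.
by rewrite -lee_fin /normal_cdf normal_prob_fin// probability_le1.
Qed.

Lemma normal_prob_set1 (R : realType) (t : R) : normal_prob (0 : R) 1 [set t] = 0%E.
Proof. by rewrite /normal_prob integral_set1. Qed.

Lemma normal_prob_ray (R : realType) (t : R) :
  normal_prob (0 : R) 1 `]-oo, t[ = (normal_cdf t)%:E.
Proof.
rewrite /normal_cdf normal_prob_fin//.
have -> : `]-oo, t]%classic = `]-oo, t[ `|` [set t].
  by rewrite setUitv1// bnd_simp.
rewrite measureU//= ?normal_prob_set1 ?adde0//.
by apply/seteqP; split => // x [] /= + xt; rewrite in_itv/= xt ltxx.
Qed.

Lemma uniform_prob_ray (R : realType) (a : R) : 0 <= a <= 1 ->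
  uniform_prob (@ltr01 R) `]-oo, a[ = a%:E.
Proof.
move=> /andP[a0 a1]; rewrite /uniform_prob integral_uniform_pdf.
have -> : `]-oo, a[ `&` `[0, 1] = `[0, a[%classic.
  apply/seteqP; split => x /=; rewrite !in_itv/=.
    by move=> [-> /andP[->]].
  by move=> /andP[-> xa]; split => //=; rewrite ltW// (lt_le_trans xa).
rewrite (eq_integral (fun=> 1%:E)); last first.
  move=> x; rewrite inE/= in_itv/= /uniform_pdf => /andP[-> xa].
  by rewrite ltW ?(lt_le_trans xa)//= subr0 invr1.
rewrite integral_cst//= lebesgue_measure_itv/= lte_fin mul1e.
move: a0; rewrite le_eqVlt => /predU1P[<-|->]; first by rewrite ltxx.
by rewrite -EFinD subr0.
Qed.

Lemma has_product_law_coord (R : realType) (d : nat) (dT : measure_display)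
    (T : measurableType dT) (P : probability T R) (X : T -> 'rV[R]_d)
    (mu : probability (measurableTypeR R) R) (i : 'I_d) (A : set R) :
  has_product_law P X mu -> measurable A ->
  P [set w | A (X w ord0 i)] = mu A.
Proof.
move=> [mX HX] mA.
have -> : [set w | A (X w ord0 i)] =
  [set w | forall j, (if j == i then A else setT) (X w ord0 j)].
  apply/seteqP; split => w /=; first by move=> Aw j; case: eqP => // ->.
  by move=> /(_ i); rewrite eqxx.
rewrite (HX (fun j => if j == i then A else setT)); last by move=> j; case: ifP.
rewrite (bigD1 i)//= eqxx big1 ?mule1// => j /negbTE ->.
exact: probability_setT.
Qed.

(** The value at 0 is arbitrary, but a single point does not affect
measurability. *)
Lemma normal_quantile_measurable (R : realType) (dT : measure_display)
    (T : measurableType dT) (Y : T -> R) :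
  measurable_fun setT Y -> (forall w, 0 <= Y w < 1) ->
  measurable_fun setT (fun w => normal_quantile (Y w)).
Proof.
move=> mY Y01; apply: (measurability _ (RGenInftyO.measurableE R)).
move=> _ [_ [t ->] <-]; rewrite setTI.
have -> : (fun w => normal_quantile (Y w)) @^-1` `]-oo, t[ =
   (Y @^-1` `]0, normal_cdf t[) `|`
   (Y @^-1` [set y | y = 0 /\ normal_quantile y < t]).
  apply/seteqP; split => w /=; rewrite !in_itv/=.
    have /andP[] := Y01 w; rewrite le_eqVlt => /predU1P[<- _ ?|Y0 Y1].
      by right.
    by rewrite normal_quantile_lt ?Y0// => ->; left.
  move=> [/andP[Y0]|[_]//]; rewrite -normal_quantile_lt// Y0.
  by case/andP: (Y01 w).
apply: measurableU.
  by rewrite -[X in measurable X]setTI; apply: mY.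
rewrite -[X in measurable X]setTI; apply: mY => //.
case: (pselect (normal_quantile (0 : R) < t)) => h.
  rewrite (_ : [set y | _] = [set 0])//; apply/seteqP; split => y /=.
    by case.
  by move=> ->.
rewrite (_ : [set y | _] = set0)//; apply/seteqP; split => y //= [->].
by move=> /h.
Qed.

(** Open rays form a generating pi-system, so the distribution function
determines the law. *)
Lemma normal_law_integral (R : realType) (dT : measure_display)
    (T : measurableType dT) (P : probability T R) (Z : T -> R) (g : R -> \bar R) :
  measurable_fun setT Z ->
  (forall t, P [set w | Z w < t] = (normal_cdf t)%:E) ->
  measurable_fun setT g -> (forall x, 0 <= g x)%E ->
  (\int[P]_w g (Z w) = \int[normal_prob (0 : R) 1]_x g x)%E.
Proof.
move=> mZ HZ mg g0.
pose mmixin := @isMeasurableFun.Build _ _ T (measurableTypeR R) Z mZ.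
pose Z' : {RV P >-> measurableTypeR R} := HB.pack Z mmixin.
rewrite -(@ge0_integral_distribution _ _ T (measurableTypeR R) R P Z' g)//; apply: eq_measure_integral => A mA _.
apply: (@measure_unique _ R (measurableTypeR R) (@RGenInftyO.G R)
  (fun n => `]-oo, n%:R[%classic) _ _ _ _ (distribution P Z')
  (normal_prob (0 : R) 1)) => //.
- exact: RGenInftyO.measurableE.
- move=> _ _ [s ->] [t ->]; exists (Num.min s t).
  by apply/seteqP; split => x /=; rewrite !in_itv/= lt_min => /andP.
- by move=> n; exists n%:R.
- rewrite -subTset => x _; exists (Num.truncn x).+1 => //=.
  by rewrite in_itv/= Num.Theory.truncnS_gt.
- move=> _ [t ->]; apply: (@etrans _ _ (P [set w | Z w < t])).
    by congr (P _); apply/seteqP; split => w /=; rewrite in_itv.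
  by rewrite HZ -normal_prob_ray.
- by move=> n; rewrite (le_lt_trans (probability_le1 _ _)) ?ltry.
Qed.

(** The density is almost everywhere equal to the Radon-Nikodym derivative. *)
Lemma integral_normal_prob (R : realType) (f : R -> \bar R) :
  measurable_fun setT f -> (forall x, 0 <= f x)%E ->
  (\int[normal_prob (0 : R) 1]_x f x =
   \int[lebesgue_measure]_x (f x * (normal_pdf 0 1 x)%:E))%E.
Proof.
move=> mf f0.
have dom := normal_prob_dominates (0 : R) 1.
rewrite -(Radon_Nikodym_SigmaFinite.change_of_variables dom)//=.
have mRN : measurable_fun setT (Radon_Nikodym_SigmaFinite.f (normal_prob (0 : R) 1) lebesgue_measure).
  exact: measurable_int (Radon_Nikodym_SigmaFinite.f_integrable dom).
have mpdf : measurable_fun setT (fun x : R => (normal_pdf 0 1 x)%:E).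
  by apply/measurable_EFinP; exact: measurable_normal_pdf.
apply: ae_eq_integral => //.
- exact: emeasurable_funM.
- exact: emeasurable_funM.
- apply: ae_eqe_mul2l; apply: integral_ae_eq => //.
  + exact: Radon_Nikodym_SigmaFinite.f_integrable.
  + by move=> E _ mE; rewrite -Radon_Nikodym_SigmaFinite.f_integral.
Qed.

(** Multiplying the standard density by exp(5 x^2 / 12) leaves
exp(- x^2 / 12), which up to a constant is the density of variance 6. *)
Lemma normal_gauss_moment (R : realType) :
  (\int[normal_prob (0 : R) 1]_x (expR (5 / 12 * x ^+ 2))%:E =
   (normal_peak 1 / normal_peak (Num.sqrt 6))%:E)%E.
Proof.
have s0 : Num.sqrt 6 != 0 :> R by rewrite gt_eqF// sqrtr_gt0.
rewrite integral_normal_prob; last 2 first.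
- apply/measurable_EFinP/measurableT_comp => //.
  by apply: measurable_funM => //; exact: measurable_funX.
- by move=> x; rewrite lee_fin expR_ge0.
transitivity (\int[lebesgue_measure]_x ((normal_peak 1 / normal_peak (Num.sqrt 6))%:E
    * (normal_pdf (0 : R) (Num.sqrt 6) x)%:E))%E.
  apply: eq_integral => x _; rewrite -!EFinM !normal_pdfE ?oner_eq0//; congr EFin.
  rewrite mulrCA -[RHS]mulrA; congr (_ * _).
  rewrite mulKf ?gt_eqF ?normal_peak_gt0// /normal_fun -expRD; congr expR.
  by rewrite sqr_sqrtr// expr1n subr0 !mulr2n; field.
rewrite ge0_integralZl// ?integral_normal_pdf ?mule1//.
- by apply/measurable_EFinP; exact: measurable_normal_pdf.
- by move=> x _; rewrite lee_fin normal_pdf_ge0.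
- by rewrite lee_fin divr_ge0// normal_peak_ge0.
Qed.

(** * A Koksma-Hlawka inequality for combinations of boxes *)

Definition ray_set {R : realType} (o : option R) : set R :=
  if o is Some t then `]-oo, t[%classic else setT.

Definition ray_prob {R : realType} (o : option R) : R :=
  if o is Some t then normal_cdf t else 1.

Definition box_prob {R : realType} {d : nat} (A : {ffun 'I_d -> option R}) : R :=
  \prod_(i < d) ray_prob (A i).

Lemma measurable_ray_set (R : realType) (o : option R) : measurable (ray_set o).
Proof. by case: o => [t|] /=. Qed.

Definition coord_measurable {R : realType} {d : nat} {dT : measure_display}
    {T : measurableType dT} (X : T -> 'rV[R]_d) : Prop :=
  forall i : 'I_d, measurable_fun [set: T] (fun w => X w ord0 i).

Lemma box_indicE (R : realType) (d : nat) (T : Type) (X : T -> 'rV[R]_d)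
    (A : {ffun 'I_d -> option R}) :
  (fun w => box_indic A (X w)) = \1_[set w | forall i, ray_set (A i) (X w ord0 i)].
Proof.
apply/funext => w; rewrite indicE /box_indic.
have rE i : ray_indic (A i) (X w ord0 i) = (X w ord0 i \in ray_set (A i))%:R :> R.
  case: (A i) => [t|] /=; last by rewrite in_setT.
  by congr (_%:R); rewrite mem_setE in_itv.
have [wA|wA] := boolP (w \in _).
  rewrite big1// => i _; rewrite rE; move: wA; rewrite inE => /(_ i) h.
  by rewrite mem_set.
have /existsNP[i Hi] : ~ (forall i, ray_set (A i) (X w ord0 i)).
  by move=> h; move/negP: wA; apply; rewrite inE.
by rewrite (bigD1 i)//= rE memNset// mul0r.
Qed.

Lemma measurable_box (R : realType) (d : nat) (dT : measure_display)
    (T : measurableType dT) (X : T -> 'rV[R]_d) (A : {ffun 'I_d -> option R}) :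
  coord_measurable X ->
  measurable [set w | forall i, ray_set (A i) (X w ord0 i)].
Proof.
move=> mX.
rewrite (_ : [set w | _] = \bigcap_(i in [set: 'I_d]) ((fun w => X w ord0 i) @^-1` ray_set (A i))).
  apply: fin_bigcap_measurable => // i _.
  by rewrite -[X in measurable X]setTI; apply: mX => //; exact: measurable_ray_set.
by apply/seteqP; split => w /= h i; [move=> _; exact: h|exact: (h i Logic.I)].
Qed.

(** The only place where the independence of the coordinates of X is used. *)
Lemma normal_box_prob (R : realType) (d : nat) (dT : measure_display)
    (T : measurableType dT) (P : probability T R) (X : T -> 'rV[R]_d)
    (A : {ffun 'I_d -> option R}) : std_normal_vector P X ->
  P [set w | forall i, ray_set (A i) (X w ord0 i)] = (box_prob A)%:E.
Proof.
move=> [mX HX]; rewrite (HX (fun i => ray_set (A i))); last first.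
  by move=> i; exact: measurable_ray_set.
rewrite /box_prob -prodEFin; apply: eq_bigr => i _.
case: (A i) => [t|] /=; first exact: normal_prob_ray.
exact: probability_setT.
Qed.

Lemma box_combination_measurable (R : realType) (d : nat) (dT : measure_display)
    (T : measurableType dT) (X : T -> 'rV[R]_d) V (phi : 'rV[R]_d -> R) :
  coord_measurable X -> box_combination V phi ->
  measurable_fun [set: T] (fun w => phi (X w)).
Proof.
move=> mX [l [_ ->]]; apply: measurable_sum => p.
apply: measurable_funM => //; rewrite box_indicE.
by apply: measurable_indic; exact: measurable_box.
Qed.

Lemma box_combination_expectation (R : realType) (d : nat) (dT : measure_display)
    (T : measurableType dT) (P : probability T R) (X : T -> 'rV[R]_d)
    (l : seq (R * {ffun 'I_d -> option R})) : std_normal_vector P X ->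
  P.-integrable setT (fun w => (\sum_(p <- l) p.1 * box_indic p.2 (X w))%:E) /\
  (\int[P]_w (\sum_(p <- l) p.1 * box_indic p.2 (X w))%:E =
    (\sum_(p <- l) p.1 * box_prob p.2)%:E)%E.
Proof.
move=> PX; have mX : coord_measurable X by case: PX.
elim: l => [|[c A] l [IH1 IH2]].
  rewrite (_ : (fun w => _) = cst 0%E); last first.
    by apply/funext => w; rewrite big_nil.
  by rewrite big_nil integral0; split => //; exact: integrable0.
have E : (fun w => (\sum_(p <- (c, A) :: l) p.1 * box_indic p.2 (X w))%:E) =
  (fun w => c%:E * (\1_[set w | forall i, ray_set (A i) (X w ord0 i)] w)%:E)%E \+
  (fun w => (\sum_(p <- l) p.1 * box_indic p.2 (X w))%:E).
  by apply/funext => w; rewrite big_cons/= -(box_indicE X A) EFinD EFinM.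
have mA := measurable_box A mX.
have I0 : P.-integrable setT (fun w => (\1_[set w | forall i, ray_set (A i) (X w ord0 i)] w)%:E).
  by apply: integrable_indic => //; rewrite ?setIT// (le_lt_trans (probability_le1 _ _))// ltry.
have I1 := integrableZl measurableT c I0.
rewrite E; split; first exact: integrableD.
rewrite integralD//= integralZl// integral_indic// setIT IH2 big_cons EFinD EFinM.
by congr (_ * _ + _)%E; exact: normal_box_prob.
Qed.

Lemma ray_prob_bound (R : realType) (o : option R) : 0 <= ray_prob o <= 1.
Proof.
case: o => [t|] /=; last by rewrite ler01 lexx.
by have /andP[/ltW -> /ltW] := normal_cdf01 t.
Qed.

Lemma prod_unit_interval (R : realType) (d : nat) (a : 'I_d -> R) :
  (forall i, 0 <= a i <= 1) -> 0 <= \prod_(i < d) a i <= 1.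
Proof.
move=> a01; apply/andP; split; first by apply: prodr_ge0 => i _; case/andP: (a01 i).
by apply: Num.Theory.prodr_ile1 => i _.
Qed.

(** Up to the quantile transform the box is [0, a[ with a_i the normal
probability of its i-th ray; an absent ray gives a_i = 1, which constrains
nothing because the coordinates are below 1. *)
Lemma discrepancy_box (R : realType) (d n : nat) (y : 'I_n -> 'rV[R]_d)
    (A : {ffun 'I_d -> option R}) :
  (forall j i, 0 < y j ord0 i < 1) ->
  `|n%:R^-1 * \sum_(j < n) box_indic A (map_mx normal_quantile (y j)) - box_prob A|
  <= star_discrepancy y.
Proof.
move=> y01; rewrite /star_discrepancy.
apply: ub_le_sup; last first.
  exists (\row_i ray_prob (A i)).
    by move=> i; rewrite mxE ray_prob_bound.
  rewrite mulrC -sum1_card natr_sum /box_prob.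
  congr (`|_ * _ - _|); last by apply: eq_bigr => i _; rewrite mxE.
  rewrite big_mkcond; apply: eq_bigr => j _ /=; rewrite inE /=.
  have E i : ray_indic (A i) (map_mx normal_quantile (y j) ord0 i) =
      (y j ord0 i \in `[0, (\row_i ray_prob (A i)) ord0 i[)%:R.
    have /andP[y0 y1] := y01 j i; rewrite !mxE in_itv/= (ltW y0)/=.
    by case: (A i) => [t|] /=; rewrite ?normal_quantile_lt ?y0 ?y1.
  rewrite /box_indic; case: ifPn => [/forallP h|/forallPn[i hi]].
    by rewrite big1// => i _; rewrite E h.
  by rewrite (bigD1 i)//= E (negbTE hi) mul0r.
exists 2 => _ [a a01 <-].
have /andP[p0 p1] := prod_unit_interval a01.
set c := (X in `|X - _|).
have c0 : 0 <= c by rewrite divr_ge0.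
have c1 : c <= 1.
  rewrite /c; case: (posnP n) => n0.
    by rewrite [n%:R](_ : _ = 0) ?invr0 ?mulr0// n0.
  rewrite ler_pdivrMr ?ltr0n// mul1r ler_nat -[X in (_ <= X)%N]card_ord.
  exact: max_card.
by rewrite ler_norml; lra.
Qed.

(** Both the average over the points and the expectation are linear, so the
error is bounded term by term. *)
Lemma koksma_hlawka (R : realType) (d n : nat) (y : 'I_n -> 'rV[R]_d)
    (dT : measure_display) (T : measurableType dT) (P : probability T R)
    (X : T -> 'rV[R]_d) V (phi : 'rV[R]_d -> R) : std_normal_vector P X ->
  (forall j i, 0 < y j ord0 i < 1) -> box_combination V phi ->
  `|estimator phi y - fine (\int[P]_w (phi (X w))%:E)%E| <= V * star_discrepancy y.
Proof.
move=> PX y01 [l [lV ->]].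
have [_ ->] := box_combination_expectation l PX.
rewrite /estimator exchange_big/= mulr_sumr -sumrB.
have D0 : 0 <= star_discrepancy y.
  exact: le_trans (discrepancy_box [ffun=> None] y01).
apply: le_trans (_ : (\sum_(p <- l) `|p.1|) * star_discrepancy y <= _); last first.
  by rewrite ler_wpM2r.
rewrite mulr_suml; apply: le_trans (ler_norm_sum _ _ _) _.
apply: ler_sum => p _; rewrite -mulr_sumr mulrCA -mulrBr normrM ler_wpM2l//.
exact: discrepancy_box.
Qed.

(** * Gaussian domination outside the cube *)

(** Jensen's inequality for the power function and the uniform distribution on
a list: the mean of x :: s is a convex combination of x and the mean of s. *)
Lemma powR_mean_le (R : realType) (I : Type) (s : seq I) (a : I -> R) (q : R) :
  1 <= q -> (forall i, 0 <= a i) ->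
  ((size s)%:R^-1 * \sum_(i <- s) a i) `^ q <=
  (size s)%:R^-1 * \sum_(i <- s) a i `^ q.
Proof.
move=> q1 a0; have q0 : q != 0 by rewrite gt_eqF// (lt_le_trans _ q1).
elim: s => [|i s IH]; first by rewrite !big_nil !mulr0 powR0.
rewrite !big_cons /= -[(size s).+1%:R]natr1; set m : R := (size s)%:R in IH *.
have m0 : 0 <= m by rewrite ler0n.
have t0 : 0 <= (m + 1)^-1 by rewrite invr_ge0; lra.
have t1 : (m + 1)^-1 <= 1 by rewrite invf_le1; lra.
set A := \sum_(j <- s) a j in IH *; set Q := \sum_(j <- s) a j `^ q in IH *.
have A0 : 0 <= A by apply: sumr_ge0.
have E b S : (m = 0 -> S = 0) ->
   (m + 1)^-1 * (b + S) = (m + 1)^-1 * b + (1 - (m + 1)^-1) * (m^-1 * S).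
  move=> mS; have [m00|mn0] := eqVneq m 0; last by field; rewrite mn0/= gt_eqF; lra.
  by rewrite (mS m00) m00; ring.
have sz0 (F : I -> R) : m = 0 -> \sum_(j <- s) F j = 0.
  by move=> /eqP; rewrite pnatr_eq0 => /eqP /size0nil ->; rewrite big_nil.
rewrite !E; [|exact: sz0|exact: sz0].
have mA0 : 0 <= m^-1 * A by rewrite mulr_ge0 ?invr_ge0.
have := @convex_powR R q q1 (Itv01 t0 t1) (a i) (m^-1 * A).
rewrite !inE /= !in_itv/= !andbT => /(_ (a0 i) mA0).
rewrite !convRE /= => /le_trans; apply.
by rewrite lerD2l ler_wpM2l// subr_ge0.
Qed.

(** For large z the exponent k < 2 gives a z^k <= e z^2; on the remaining
bounded range the left-hand side is bounded. *)
Lemma powR_subquadratic (R : realType) (a k e : R) :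
  0 <= a -> 0 < k -> k < 2 -> 0 < e ->
  exists K : R, forall z, 0 <= z -> a * z `^ k <= e * z ^+ 2 + K.
Proof.
move=> a0 k0 k2 e0; pose z0 := (a / e) `^ (2 - k)^-1.
exists (a * z0 `^ k) => z z_ge0.
have K0 : 0 <= a * z0 `^ k by rewrite mulr_ge0// powR_ge0.
have [zz0|z0z] := leP z z0.
  apply: le_trans (_ : a * z0 `^ k <= _); last by rewrite lerDr mulr_ge0 ?sqr_ge0 ?ltW.
  by rewrite ler_wpM2l// ge0_ler_powR ?nnegrE ?powR_ge0 ?(ltW k0).
have zp : 0 < z by rewrite (le_lt_trans _ z0z)// powR_ge0.
apply: le_trans (_ : e * z ^+ 2 <= _); last by rewrite lerDl.
rewrite -powR_mulrn//.
rewrite (_ : 2%:R = (2 - k) + k :> R); last by rewrite subrK.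
rewrite powRD; last by apply/implyP => _; rewrite gt_eqF.
rewrite mulrA ler_wpM2r ?powR_ge0//.
rewrite mulrC -ler_pdivrMr//.
rewrite -[a / e]powRr1 ?divr_ge0 ?(ltW e0)//.
rewrite -[X in _ `^ X](@mulVf _ (2 - k)); last by rewrite subr_eq0 gt_eqF.
rewrite powRrM ge0_ler_powR ?nnegrE ?powR_ge0 ?subr_ge0 ?(ltW k2) ?(ltW zp)//.
exact: ltW.
Qed.

Lemma cube_growth_gauss (R : realType) (d : nat) (q M B k : R) :
  0 < q -> 0 < M -> 0 < B -> 0 < k -> k < 2 ->
  exists2 K : R, 0 < K & forall z, 0 <= z ->
    cube_growth d M B k z <= K * expR (z ^+ 2 / (12 * q)).
Proof.
move=> q0 M0 B0 k0 k2.
have a0 : 0 <= M * (Num.sqrt d%:R) `^ k by rewrite mulr_ge0 ?powR_ge0// ltW.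
have e0 : 0 < (12 * q)^-1 by rewrite invr_gt0 mulr_gt0.
have [K HK] := powR_subquadratic a0 k0 k2 e0.
exists (B * expR K); first by rewrite mulr_gt0 ?expR_gt0.
move=> z z0; rewrite /cube_growth -mulrA ler_pM2l// -expRD ler_expR.
by rewrite powRM ?sqrtr_ge0// mulrA (le_trans (HK z z0))// addrC mulrC.
Qed.

(** Its q-th power is dominated by a sum of exp(5 x_i^2 / 12), integrable for
the normal law. *)
Definition gauss_weight {R : realType} {d : nat} (q : R) (x : 'rV[R]_d) : R :=
  \sum_(i < d) expR (5 / (12 * q) * x ord0 i ^+ 2).

Lemma exists_max_coord (R : realType) (d : nat) (x : 'rV[R]_d.+1) :
  exists i, forall j, `|x ord0 j| <= `|x ord0 i|.
Proof.
have [i _ Hi] := @Order.TotalTheory.arg_maxP _ R 'I_d.+1 ord0 xpredT (fun i => `|x ord0 i|) isT.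
by exists i => j; exact: Hi.
Qed.

Lemma gauss_weight_ge (R : realType) (d : nat) (q : R) (x : 'rV[R]_d) i :
  expR (5 / (12 * q) * x ord0 i ^+ 2) <= gauss_weight q x.
Proof.
by rewrite /gauss_weight (bigD1 i)//= lerDl sumr_ge0// => j _; exact: expR_ge0.
Qed.

Lemma gauss_weight_ge0 (R : realType) (d : nat) (q : R) (x : 'rV[R]_d) :
  0 <= gauss_weight q x.
Proof. by apply: sumr_ge0 => j _; exact: expR_ge0. Qed.

(** Let z be the largest |x_i|.  If z <= r only the rounding error matters.
Otherwise both values of f are at most K exp(z^2 / (12 q)), and since z > r
the factor exp((z^2 - r^2) / (3 q)) is at least 1; note that
1 / 12 + 1 / 3 = 5 / 12. *)
Lemma growth_tail (R : realType) (d : nat) (q M B k : R) :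
  0 < q -> 0 < M -> 0 < B -> 0 < k -> k < 2 ->
  exists2 K : R, 0 < K & forall f : 'rV[R]_d.+1 -> R, growth_class M B k f ->
    (forall x, `|f x| <= K * gauss_weight q x) /\
    forall r N x, 0 <= r -> (0 < N)%N ->
      `|f x - f (grid_round r N (enum 'I_d.+1) x)| <=
      d.+1%:R * (2 * r / N%:R) * cube_growth d.+1 M B k r +
      K * expR (- r ^+ 2 / (3 * q)) * gauss_weight q x.
Proof.
move=> q0 M0 B0 k0 k2.
have [K K0 HK] := @cube_growth_gauss R d.+1 q M B k q0 M0 B0 k0 k2.
have q12 : 0 < 12 * q by rewrite mulr_gt0.
exists (2 * K) => [|f fG]; first by rewrite mulr_gt0.
have fb (x : 'rV[R]_d.+1) z : 0 <= z -> (forall j, `|x ord0 j| <= z) -> `|f x| <= K * expR (z ^+ 2 / (12 * q)).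
  move=> z0 xz; apply: le_trans (HK z z0).
  have := growth_class_bound finset.set0 M0 B0 k0 z0 fG xz.
  by rewrite /mixed_partial enum_set0.
split=> [x|r N x r0 N0].
  have [i Hi] := exists_max_coord x.
  apply: le_trans (fb x _ (normr_ge0 _) Hi) _.
  rewrite -mulrA mulrCA ler_wpM2l ?(ltW K0)//.
  apply: le_trans (_ : gauss_weight q x <= _); last first.
    by have := gauss_weight_ge0 q x; lra.
  apply: le_trans (gauss_weight_ge q x i); rewrite ler_expR real_normK ?num_real//.
  rewrite mulrC ler_wpM2r ?sqr_ge0// ler_pdivlMr// mulVf ?gt_eqF//; lra.
have S0 : 0 <= cube_growth d.+1 M B k r by rewrite mulr_ge0 ?expR_ge0// ltW.
have h0 : 0 <= 2 * r / N%:R by rewrite divr_ge0// mulr_ge0.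
have [i Hi] := exists_max_coord x.
have [xr|rx] := leP `|x ord0 i| r.
  rewrite -[leLHS]addr0 lerD//.
    by apply: grid_round_close => // j; exact: le_trans (Hi j) xr.
  by rewrite !mulr_ge0 ?expR_ge0 ?gauss_weight_ge0// ltW.
rewrite -[leLHS]add0r lerD//; first by apply: mulr_ge0 => //; exact: mulr_ge0.
apply: le_trans (ler_normB _ _) _.
have H1 := fb x _ (normr_ge0 _) Hi.
have H2 : `|f (grid_round r N (enum 'I_d.+1) x)| <= K * expR (`|x ord0 i| ^+ 2 / (12 * q)).
  apply: fb => // j; apply: le_trans (ltW rx).
  rewrite mxE mem_enum; apply: grid_node_bound => //; exact: grid_index_le.
apply: le_trans (lerD H1 H2) _.
rewrite (_ : _ + _ = 2 * K * expR (`|x ord0 i| ^+ 2 / (12 * q))); last by ring.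
rewrite -[leRHS]mulrA ler_wpM2l ?mulr_ge0 ?(ltW K0)//.
apply: le_trans (_ : expR (- r ^+ 2 / (3 * q)) * expR (5 / (12 * q) * x ord0 i ^+ 2) <= _).
  rewrite -expRD ler_expR real_normK ?num_real//.
  have rx2 : r ^+ 2 <= x ord0 i ^+ 2.
    by rewrite -(real_normK (num_real (x ord0 i))) lerXn2r ?nnegrE// ltW.
  have -> : 5 / (12 * q) * x ord0 i ^+ 2 = x ord0 i ^+ 2 / (12 * q) + x ord0 i ^+ 2 / (3 * q).
    by field; rewrite gt_eqF.
  rewrite addrCA lerDl mulNr addrC subr_ge0.
  by rewrite ler_pM2r// invr_gt0 mulr_gt0.
by rewrite ler_wpM2l ?expR_ge0// gauss_weight_ge.
Qed.

Lemma measurable_gauss_weight (R : realType) (d : nat) (q : R) (dT : measure_display)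
    (T : measurableType dT) (X : T -> 'rV[R]_d) : coord_measurable X ->
  measurable_fun setT (fun w => gauss_weight q (X w)).
Proof.
move=> mX; apply: measurable_sum => i; apply: measurableT_comp => //.
by apply: measurable_funM => //; apply: measurable_funX; exact: mX.
Qed.

(** A pointwise limit of step functions: on the cube of half-width m a grid fine
enough approximates f to within 1 / (m + 1). *)
Lemma growth_measurable (R : realType) (d : nat) (M B k : R) (dT : measure_display)
    (T : measurableType dT) (X : T -> 'rV[R]_d) f :
  0 < M -> 0 < B -> 0 < k -> growth_class M B k f -> coord_measurable X ->
  measurable_fun setT (fun w => f (X w)).
Proof.
move=> M0 B0 k0 fG mX.
pose c m : R := d%:R * (2 * m%:R) * cube_growth d M B k m%:R * m.+1%:R.
have c0 m : 0 <= c m by rewrite !mulr_ge0// ?expR_ge0// ltW.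
(* c m is (m + 1) N times the rounding error with N cells. *)
pose N m := (Num.truncn (c m)).+1.
apply: (@measurable_fun_cvg _ _ _ setT
  (fun m w => f (grid_round m%:R (N m) (enum 'I_d) (X w)))).
  move=> m; apply: (@box_combination_measurable _ _ _ _ X _
    (fun x => f (grid_round m%:R (N m) (enum 'I_d) x)) mX).
  exact: (grid_box_combination M0 B0 k0 (ler0n _ m) _ fG).
move=> w _; apply/cvgrPdist_le => e e0; near=> m.
apply: (@le_trans _ _ m.+1%:R^-1).
  apply: le_trans (@grid_round_close _ _ M B k m%:R (N m) f (X w) M0 B0 k0 _ _ fG _) _ => //.
    by near: m; apply: filter_forall => i; exact: nbhs_infty_ger.
  rewrite (_ : _ * _ = c m / (N m)%:R / m.+1%:R); last first.
    by rewrite /c; field; rewrite nat1r !pnatr_eq0.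
  rewrite ler_pdivrMr ?ltr0n// mulVf ?pnatr_eq0//.
  rewrite ler_pdivrMr ?ltr0n// mul1r ltW//.
  by rewrite Num.Theory.truncnS_gt.
apply: ltW; near: m; exact: (near_infty_natSinv_lt (PosNum e0)).
Unshelve. all: by end_near. Qed.

(** * Gaussian moments of the sample points *)

(** Marginal laws suffice for the tail estimates, whose weight is a sum over the
coordinates. *)
Definition normal_coords {R : realType} {d : nat} {dT : measure_display}
    {T : measurableType dT} (P : probability T R) (X : T -> 'rV[R]_d) : Prop :=
  coord_measurable X /\
  forall i t, P [set w | X w ord0 i < t] = (normal_cdf t)%:E.

Definition gauss_moment_const {R : realType} : R :=
  normal_peak 1 / normal_peak (Num.sqrt 6).

Lemma gauss_moment_const_ge0 (R : realType) : 0 <= @gauss_moment_const R.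
Proof. by rewrite divr_ge0// normal_peak_ge0. Qed.

Lemma std_normal_coords (R : realType) (d : nat) (dT : measure_display)
    (T : measurableType dT) (P : probability T R) (X : T -> 'rV[R]_d) :
  std_normal_vector P X -> normal_coords P X.
Proof.
move=> PX; split; first by case: PX.
move=> i t; rewrite -normal_prob_ray.
by rewrite -(has_product_law_coord i PX)//; congr (P _); apply/seteqP; split => w /=; rewrite in_itv.
Qed.

Lemma uniform_coord0 (R : realType) (d : nat) (dT : measure_display)
    (T : measurableType dT) (P : probability T R) (Y : T -> 'rV[R]_d) i :
  uniform_vector P Y ->
  measurable [set w | Y w ord0 i = 0] /\ P [set w | Y w ord0 i = 0] = 0%E.
Proof.
move=> PY; split.
  rewrite (_ : [set w | _] = (fun w => Y w ord0 i) @^-1` [set 0])//.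
  by rewrite -[X in measurable X]setTI; case: PY => mY _; apply: mY.
rewrite (@has_product_law_coord _ _ _ _ P Y _ i [set 0] PY)//=.
by rewrite /uniform_prob integral_set1.
Qed.

(** The quantile transform turns uniform marginals into normal ones; the event
that a coordinate is 0, where the quantile is a default value, is null. *)
Lemma uniform_normal_coords (R : realType) (d : nat) (dT : measure_display)
    (T : measurableType dT) (P : probability T R) (Y : T -> 'rV[R]_d) :
  (forall w i, 0 <= Y w ord0 i < 1) -> uniform_vector P Y ->
  normal_coords P (fun w => map_mx normal_quantile (Y w)).
Proof.
move=> Y01 PY; have mY : coord_measurable Y by case: PY.
have mQ : coord_measurable (fun w => map_mx normal_quantile (Y w)).
  move=> i; under eq_fun do rewrite mxE.
  exact: normal_quantile_measurable (mY i) _.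
split=> // i t.
have [m0 P0] := uniform_coord0 i PY.
have mA : measurable [set w | (map_mx normal_quantile (Y w)) ord0 i < t].
  rewrite (_ : [set w | _] = (fun w => (map_mx normal_quantile (Y w)) ord0 i) @^-1` `]-oo, t[).
    by rewrite -[X in measurable X]setTI; apply: mQ.
  by apply/seteqP; split => w /=; rewrite in_itv.
have mB : measurable [set w | Y w ord0 i < normal_cdf t].
  rewrite (_ : [set w | _] = (fun w => Y w ord0 i) @^-1` `]-oo, normal_cdf t[).
    by rewrite -[X in measurable X]setTI; apply: mY.
  by apply/seteqP; split => w /=; rewrite in_itv.
have cdf01 := normal_cdf01 t.
transitivity (P [set w | Y w ord0 i < normal_cdf t]).
  rewrite -(measureU0 mA m0 P0) -(measureU0 mB m0 P0); congr (P _).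
  apply/seteqP; split => w /=; rewrite mxE.
    case: (eqVneq (Y w ord0 i) 0) => [|Y0 [|]]; [by right| |by right].
    have /andP[Yge0 Y1] := Y01 w i.
    by rewrite normal_quantile_lt ?lt0r ?Y0 ?Yge0//; left.
  case: (eqVneq (Y w ord0 i) 0) => [|Y0 [|]]; [by right| |by right].
  have /andP[Yge0 Y1] := Y01 w i.
  by rewrite -normal_quantile_lt ?lt0r ?Y0 ?Yge0//; left.
rewrite -[RHS]uniform_prob_ray; last by case/andP: cdf01 => /ltW -> /ltW.
by rewrite -(has_product_law_coord i PY)//; congr (P _); apply/seteqP; split => w /=; rewrite in_itv.
Qed.

Lemma gauss_weight1_integral (R : realType) (d : nat) (dT : measure_display)
    (T : measurableType dT) (P : probability T R) (X : T -> 'rV[R]_d) :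
  normal_coords P X ->
  (\int[P]_w (gauss_weight 1 (X w))%:E = (d%:R * gauss_moment_const)%:E)%E.
Proof.
move=> [mX HX]; rewrite /gauss_weight.
under eq_integral do rewrite -sumEFin.
rewrite ge0_integral_sum//; last first.
  move=> i; apply/measurable_EFinP/measurableT_comp => //.
  by apply: measurable_funM => //; apply: measurable_funX; exact: mX.
rewrite (eq_bigr (fun=> gauss_moment_const%:E)).
  by rewrite sumEFin sumr_const card_ord mulr_natl.
move=> i _; rewrite -normal_gauss_moment mulr1.
rewrite (normal_law_integral (g := fun x => (expR (5 / 12 * x ^+ 2))%:E) (mX i) (HX i))//.
  apply/measurable_EFinP/measurableT_comp => //.
  by apply: measurable_funM => //; exact: measurable_funX.
Qed.

Lemma gauss_weight_le1 (R : realType) (d : nat) (q : R) (x : 'rV[R]_d) :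
  1 <= q -> gauss_weight q x <= gauss_weight 1 x.
Proof.
move=> q1; apply: ler_sum => i _; rewrite ler_expR ler_wpM2r ?sqr_ge0//.
rewrite mulr1 ler_pM2l// lef_pV2 ?posrE ?mulr_gt0//; lra.
Qed.

Lemma gauss_weight_integrable (R : realType) (d : nat) (q : R) (dT : measure_display)
    (T : measurableType dT) (P : probability T R) (X : T -> 'rV[R]_d) :
  1 <= q -> normal_coords P X ->
  P.-integrable setT (EFin \o (fun w => gauss_weight q (X w))) /\
  (\int[P]_w gauss_weight q (X w) <= d%:R * gauss_moment_const)%R.
Proof.
move=> q1 PX; have [mX _] := PX.
have m1 p : measurable_fun setT (fun w => (gauss_weight p (X w))%:E).
  by apply/measurable_EFinP; exact: measurable_gauss_weight.
have I1 : P.-integrable setT (EFin \o (fun w => gauss_weight 1 (X w))).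
  apply/integrableP; split; first exact: m1.
  under eq_integral do rewrite /= ger0_norm ?gauss_weight_ge0//.
  by rewrite gauss_weight1_integral// ltry.
have Iq : P.-integrable setT (EFin \o (fun w => gauss_weight q (X w))).
  apply: le_integrable I1 => //; first exact: m1.
  by move=> w _; rewrite /= !ger0_norm ?gauss_weight_ge0// lee_fin gauss_weight_le1.
split=> //; apply: le_trans (le_Rintegral _ Iq I1 _) _ => //.
  by move=> w _; exact: gauss_weight_le1.
by rewrite /Rintegral gauss_weight1_integral.
Qed.

(** Jensen's inequality over the d coordinates. *)
Lemma gauss_weight_powR (R : realType) (d : nat) (q : R) (x : 'rV[R]_d) :
  1 <= q -> (0 < d)%N ->
  gauss_weight q x `^ q <= d%:R `^ q * (d%:R^-1 * gauss_weight 1 x).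
Proof.
move=> q1 d0; have q0 : q != 0 by rewrite gt_eqF// (lt_le_trans _ q1).
have := @powR_mean_le R _ (index_enum 'I_d) (fun i => expR (5 / (12 * q) * x ord0 i ^+ 2)) q q1.
rewrite (_ : size _ = d); last by rewrite -[RHS]card_ord cardE enumT.
have dn0 : d%:R != 0 :> R by rewrite pnatr_eq0 -lt0n.
move=> /(_ (fun i => expR_ge0 _)) H.
have {1}-> : gauss_weight q x = d%:R * (d%:R^-1 * gauss_weight q x) by rewrite mulVKf.
rewrite powRM//; last by rewrite mulr_ge0 ?invr_ge0 ?gauss_weight_ge0.
rewrite ler_wpM2l ?powR_ge0//; apply: le_trans H _.
rewrite ler_wpM2l ?invr_ge0//; apply: ler_sum => i _.
rewrite -expRM (_ : _ * q = 5 / (12 * 1) * x ord0 i ^+ 2)//.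
by field; rewrite q0.
Qed.

(** * The moment bound at a fixed radius *)

Lemma weight_dominated_integrable (R : realType) (d : nat) (q K : R)
    (dT : measure_display) (T : measurableType dT) (P : probability T R)
    (X : T -> 'rV[R]_d) (g : T -> R) :
  1 <= q -> 0 <= K -> normal_coords P X -> measurable_fun setT g ->
  (forall w, `|g w| <= K * gauss_weight q (X w)) ->
  P.-integrable setT (EFin \o g).
Proof.
move=> q1 K0 PX mg gK; have [Iw _] := gauss_weight_integrable q1 PX.
apply: le_integrable (integrableZl measurableT K Iw) => //.
  exact/measurable_EFinP.
by move=> w _ /=; rewrite lee_fin (le_trans (gK w))// ler_norm.
Qed.

(** Integrate the pointwise bound of |f - f o G|; all the functions involved are
dominated by the integrable weight. *)
Lemma expectation_gap (R : realType) (d : nat) (q M B k K r : R) (N : nat)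
    (dT : measure_display) (T : measurableType dT) (P : probability T R)
    (X : T -> 'rV[R]_d) (f : 'rV[R]_d -> R) (b1 b2 : R)
    (G := grid_round r N (enum 'I_d)) :
  1 <= q -> 0 < M -> 0 < B -> 0 < k -> 0 <= r -> (0 < N)%N ->
  growth_class M B k f -> 0 <= K -> 0 <= b1 -> 0 <= b2 ->
  (forall x, `|f x| <= K * gauss_weight q x) ->
  (forall x, `|f x - f (G x)| <= b1 + b2 * gauss_weight q x) ->
  std_normal_vector P X ->
  `|fine (\int[P]_w (f (G (X w)))%:E)%E - fine (\int[P]_w (f (X w))%:E)%E|
  <= b1 + b2 * (d%:R * gauss_moment_const).
Proof.
move=> q1 M0 B0 k0 r0 N0 fG K0 b10 b20 fK fGb PX.
have PX' := std_normal_coords PX; have [mX _] := PX'.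
have If : P.-integrable setT (EFin \o (fun w => f (X w))).
  apply: (weight_dominated_integrable q1 K0 PX') => //.
  exact: (growth_measurable M0 B0 k0 fG mX).
have [l [_ El]] := grid_box_combination M0 B0 k0 r0 N0 fG.
have [Ig _] := box_combination_expectation l PX.
have {}Ig : P.-integrable setT (EFin \o (fun w => f (G (X w)))).
  apply: eq_integrable Ig => // w _ /=.
  by have := congr1 (fun F => F (X w)) El; rewrite /G /= => ->.
rewrite -!/(Rintegral _ _ _) -RintegralB//.
have IB : P.-integrable setT (EFin \o (fun w => f (G (X w)) - f (X w))).
  exact: (integrableB measurableT Ig If).
apply: le_trans (le_normr_Rintegral _ _) _ => //.
have [Iw Ew] := gauss_weight_integrable q1 PX'.
have Ib : P.-integrable setT (EFin \o (fun w => b2 * gauss_weight q (X w))).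
  exact: (integrableZl measurableT b2 Iw).
have Ic : P.-integrable setT (EFin \o (fun _ : T => b1)).
  exact: finite_measure_integrable_cst.
apply: le_trans (le_Rintegral (f2 := fun w => b1 + b2 * gauss_weight q (X w)) _ _ _ _) _ => //.
- exact: (integrable_norm IB).
- exact: (integrableD measurableT Ic Ib).
- by move=> w _; rewrite distrC.
rewrite RintegralD// Rintegral_cst// RintegralZl//.
rewrite (_ : fine _ = 1) ?mulr1 ?lerD2l ?ler_wpM2l//.
by transitivity (fine (1%:E : \bar R)) => //; congr fine; exact: probability_setT.
Qed.

Lemma powRD_le (R : realType) (a b q : R) : 0 <= a -> 0 <= b -> 0 <= q ->
  (a + b) `^ q <= 2 `^ q * (a `^ q + b `^ q).
Proof.
move=> a0 b0 q0; wlog ab : a b a0 b0 / a <= b.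
  move=> H; case: (leP a b) => [|/ltW] ab; first exact: H.
  by rewrite addrC [in leRHS]addrC; exact: H.
apply: (@le_trans _ _ ((2 * b) `^ q)).
  by rewrite ge0_ler_powR ?nnegrE ?addr_ge0 ?mulr_ge0//; lra.
by rewrite powRM// ler_wpM2l ?powR_ge0// lerDr powR_ge0.
Qed.

(** Almost surely the error is at most A + b2 m, where A is deterministic and m is
the average of the weight over the points: the discrepancy term, plus the
replacement of f by f o G once in the expectation and once in the estimator.
Then split the q-th power and apply Jensen's inequality to m. *)
Lemma moment_error_le (R : realType) (d' n : nat) (d := d'.+1) (q M B k K r b1 b2 : R)
    (N : nat) (dT dX : measure_display) (T : measurableType dT)
    (TX : measurableType dX) (P : probability T R) (C : R) (y : 'I_n -> T -> 'rV[R]_d)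
    (PX : probability TX R) (X : TX -> 'rV[R]_d) (f : 'rV[R]_d -> R)
    (G := grid_round r N (enum 'I_d))
    (V := cube_growth d M B k r * (1 + 2 * r) ^+ d)
    (A := V * (C * (ln n%:R ^+ d.-1 / n%:R)) + 2 * b1 + b2 * (d%:R * gauss_moment_const)) :
  (0 < n)%N -> 1 <= q -> 0 < M -> 0 < B -> 0 < k -> 0 <= r -> (0 < N)%N ->
  growth_class M B k f -> 0 <= K -> 0 <= b1 -> 0 <= b2 -> 0 <= C ->
  (forall x, `|f x| <= K * gauss_weight q x) ->
  (forall x, `|f x - f (G x)| <= b1 + b2 * gauss_weight q x) ->
  rqmc_points P C y -> std_normal_vector PX X ->
  (moment_error P y PX X q f <=
   (2 `^ q * (A `^ q + b2 `^ q * (d%:R `^ q * gauss_moment_const)))%:E)%E.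
Proof.
move=> n0 q1 M0 B0 k0 r0 N0 fG K0 b10 b20 C0 fK fGb [y01 uy Dy] PXX.
have q0 : 0 <= q by lra.
have qn0 : q != 0 by rewrite gt_eqF//; lra.
have nn0 : n%:R != 0 :> R by rewrite pnatr_eq0 -lt0n.
pose x j w := map_mx normal_quantile (y j w).
have px j : normal_coords P (x j).
  by apply: uniform_normal_coords => //; exact: y01.
have mx j : coord_measurable (x j) by case: (px j).
pose E := fine 'E_PX[f \o X].
pose mean w := n%:R^-1 * \sum_(j < n) gauss_weight q (x j w).
pose U w : R := 2 `^ q * (A `^ q + b2 `^ q * (d%:R `^ q *
  (n%:R^-1 * \sum_(j < n) (d%:R^-1 * gauss_weight 1 (x j w))))).
have V0 : 0 <= V.
  by rewrite !mulr_ge0 ?expR_ge0 ?(ltW B0)// exprn_ge0// addr_ge0// mulr_ge0.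
have A0 : 0 <= A.
  have L0 : 0 <= ln (n%:R : R) by rewrite ln_ge0// ler1n.
  have H1 : 0 <= V * (C * (ln n%:R ^+ d.-1 / n%:R)).
    by apply: mulr_ge0 => //; apply: mulr_ge0 => //; rewrite divr_ge0// exprn_ge0.
  have H2 : 0 <= b2 * (d%:R * @gauss_moment_const R).
    by apply: mulr_ge0 => //; rewrite mulr_ge0 ?gauss_moment_const_ge0.
  by rewrite /A addr_ge0// addr_ge0// mulr_ge0.
have U_le w : (A + b2 * mean w) `^ q <= U w.
  have mean0 : 0 <= mean w.
    by rewrite mulr_ge0 ?invr_ge0// sumr_ge0// => j _; exact: gauss_weight_ge0.
  have bm0 : 0 <= b2 * mean w by exact: mulr_ge0.
  apply: le_trans (powRD_le A0 bm0 q0) _.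
  rewrite ler_wpM2l ?powR_ge0// lerD2l powRM// ler_wpM2l ?powR_ge0//.
  have := @powR_mean_le R _ (index_enum 'I_n) (fun j => gauss_weight q (x j w)) q q1.
  rewrite (_ : size _ = n); last by rewrite -[RHS]card_ord cardE enumT.
  move=> /(_ (fun j => gauss_weight_ge0 _ _)) H; apply: le_trans H _.
  rewrite mulrCA ler_wpM2l ?invr_ge0// mulr_sumr; apply: ler_sum => j _.
  exact: gauss_weight_powR.
have mean_gap w : `|estimator f (fun j => y j w) -
    estimator (f \o G) (fun j => y j w)| <= b1 + b2 * mean w.
  rewrite /estimator -mulrBr -sumrB normrM ger0_norm ?invr_ge0//.
  apply: le_trans (_ : n%:R^-1 * \sum_(j < n) (b1 + b2 * gauss_weight q (x j w)) <= _).
    rewrite ler_wpM2l ?invr_ge0//; apply: le_trans (ler_norm_sum _ _ _) _.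
    by apply: ler_sum => j _; exact: fGb.
  rewrite big_split /= sumr_const card_ord mulrDr -[b1 *+ n]mulr_natl mulKf// lerD2l.
  by rewrite -mulr_sumr mulrCA.
have gap : `|fine (\int[PX]_w (f (G (X w)))%:E)%E - E| <= b1 + b2 * (d%:R * gauss_moment_const).
  rewrite /E unlock.
  exact: (@expectation_gap _ _ q M B k K).
have est_le : {ae P, forall w, `|estimator f (fun j => y j w) - E| `^ q <= U w}.
  (* The quantile of 0 is a default value, so points with a zero coordinate
     are discarded. *)
  have y0 : {ae P, forall w, forall j i, y j w ord0 i != 0}.
    apply: filter_forall => j; apply: filter_forall => i.
    have [m0 P0] := uniform_coord0 i (uy j).
    exists [set w | y j w ord0 i = 0]; split => // w /=.
    by move=> /negP; rewrite negbK => /eqP.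
  apply: filterS2 y0 Dy => w y0 Dw; apply: le_trans (U_le w).
  rewrite ge0_ler_powR ?nnegrE//.
    rewrite addr_ge0// mulr_ge0// mulr_ge0 ?invr_ge0// sumr_ge0// => j _.
    exact: gauss_weight_ge0.
  have KH := @koksma_hlawka _ _ _ (fun j => y j w) _ _ PX X V _ PXX _
    (grid_box_combination M0 B0 k0 r0 N0 fG).
  have {}KH : `|estimator (f \o G) (fun j => y j w) -
      fine (\int[PX]_w (f (G (X w)))%:E)%E| <= V * (C * (ln n%:R ^+ d.-1 / n%:R)).
    apply: le_trans (KH _) _; last by rewrite ler_wpM2l.
    by move=> j i; have /andP[h1 ->] := y01 j w i; rewrite lt0r y0 h1.
  have := mean_gap w.
  move: KH gap; rewrite /A; rewrite !ler_norml; lra.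
have mU : measurable_fun setT (fun w => \sum_(j < n) (d%:R^-1 * gauss_weight 1 (x j w))).
  apply: measurable_sum => j; apply: measurable_funM => //.
  exact: measurable_gauss_weight.
apply: le_trans (expectation_le (Y := U) _ _ _ _ est_le) _.
- apply: (measurableT_comp (measurable_powR q)); apply: measurableT_comp => //.
  apply: measurable_funB => //; apply: measurable_funM => //.
  by apply: measurable_sum => j; exact: (growth_measurable M0 B0 k0 fG (mx j)).
- by do 4 (apply: measurable_funM => //; try apply: measurable_funD => //).
- by move=> w; exact: powR_ge0.
- move=> w; apply: le_trans (U_le w); exact: powR_ge0.
rewrite unlock.
pose c : R := 2 `^ q * b2 `^ q * d%:R `^ q * n%:R^-1 * d%:R^-1.
have c0 : 0 <= c by rewrite !mulr_ge0 ?powR_ge0 ?invr_ge0.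
have mW j : measurable_fun setT (fun w => (gauss_weight 1 (x j w))%:E).
  by apply/measurable_EFinP; exact: measurable_gauss_weight.
have W0 j w : (0 <= (gauss_weight 1 (x j w))%:E)%E by rewrite lee_fin gauss_weight_ge0.
rewrite (eq_integral (fun w => (2 `^ q * A `^ q)%:E +
    \sum_(j < n) (c%:E * (gauss_weight 1 (x j w))%:E))%E); last first.
  move=> w _; rewrite /U mulrDr EFinD; congr (_ + _)%E.
  under [in RHS]eq_bigr do rewrite -EFinM.
  by rewrite sumEFin -!mulr_sumr /c !mulrA.
rewrite ge0_integralD//; last 3 first.
- by move=> w _; rewrite lee_fin mulr_ge0 ?powR_ge0.
- by move=> w _; apply: sume_ge0 => j _; exact: mule_ge0.
- by apply: emeasurable_sum => j; exact: emeasurable_funM.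
rewrite (_ : (\int[P]_w (2 `^ q * A `^ q)%:E)%E = (2 `^ q * A `^ q)%:E); last first.
  by rewrite integral_cst// -[RHS]mule1; congr (_ * _)%E; exact: probability_setT.
rewrite ge0_integral_sum//; last 2 first.
- by move=> j; exact: emeasurable_funM.
- by move=> j w _; exact: mule_ge0.
rewrite (eq_bigr (fun=> (c * (d%:R * gauss_moment_const))%:E)); last first.
  by move=> j _; rewrite ge0_integralZl// gauss_weight1_integral.
rewrite sumEFin sumr_const card_ord -EFinD lee_fin.
rewrite [leRHS]mulrDr lerD2l -[_ *+ n]mulr_natl /c.
rewrite le_eqVlt; apply/orP; left; apply/eqP; field.
by rewrite nn0 /= pnatr_eq0.
Qed.

(** * Choice of the radius and the rate *)

(** This allows C to be replaced by a constant that is at least 1, in particular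
nonnegative. *)
Lemma rqmc_points_le (R : realType) (d n : nat) (dT : measure_display)
    (T : measurableType dT) (P : probability T R) (C C' : R)
    (y : 'I_n -> T -> 'rV[R]_d) :
  (0 < n)%N -> C <= C' -> rqmc_points P C y -> rqmc_points P C' y.
Proof.
move=> n0 CC' [y01 uy Dy]; split => //; apply: filterS Dy => w /le_trans; apply.
by rewrite ler_wpM2r// divr_ge0// exprn_ge0// ln_ge0// ler1n.
Qed.

(** The difference of the two exponents is M (4^k - 3^k) (a L)^k, which tends to
infinity with L. *)
Lemma exponential_slack (R : realType) (M k a C : R) :
  0 < M -> 0 < k -> 1 <= a -> 0 <= C ->
  exists2 L0 : R, 1 <= L0 & forall L, L0 <= L ->
    C * expR (M * (3 * a * L) `^ k) <= expR (M * (4 * a * L) `^ k).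
Proof.
move=> M0 k0 a1 C0.
pose delta : R := M * (4 `^ k - 3 `^ k).
have delta0 : 0 < delta.
  rewrite mulr_gt0// subr_gt0 gt0_ltr_powR// ?nnegrE//; lra.
exists (Num.max 1 ((C / delta) `^ k^-1)); first by rewrite le_max lexx.
move=> L; rewrite ge_max => /andP[L1 LC].
have L0 : 0 <= L by lra.
have a0 : 0 <= a by lra.
have aL0 : 0 <= a * L by rewrite mulr_ge0.
rewrite -!mulrA [(3 * (a * L)) `^ k]powRM// [(4 * (a * L)) `^ k]powRM//.
have -> : M * (4 `^ k * (a * L) `^ k) = delta * (a * L) `^ k + M * (3 `^ k * (a * L) `^ k).
  by rewrite /delta; ring.
rewrite expRD ler_wpM2r ?expR_ge0//.
apply: le_trans (_ : delta * (a * L) `^ k <= _); last first.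
  by apply: le_trans (expR_ge1Dx _); rewrite lerDr.
rewrite mulrC -ler_pdivrMr//.
have -> : C / delta = ((C / delta) `^ k^-1) `^ k.
  by rewrite -powRrM mulVf ?gt_eqF// powRr1// divr_ge0// ltW.
rewrite ge0_ler_powR ?nnegrE ?powR_ge0 ?(ltW k0)//.
by apply: le_trans LC _; rewrite ler_peMl.
Qed.


Lemma cube_growth_sqrt (R : realType) (d : nat) (M B k a b : R) : 0 <= a ->
  d%:R * a = b ->
  cube_growth d M B k (Num.sqrt a) = B * expR (M * b `^ (k / 2)).
Proof.
move=> a0 <-; have da0 : 0 <= d%:R * a by rewrite mulr_ge0.
rewrite /cube_growth.
have -> : Num.sqrt d%:R * Num.sqrt a = (d%:R * a) `^ 2^-1.
  by rewrite powR12_sqrt// sqrtrM ?ler0n.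
by rewrite -powRrM [2^-1 * k]mulrC.
Qed.

(** Here sqrt L^(d + 1) from the volume of the cube and L^d from the discrepancy
combine to L^(3 (d + 1) / 2 - 1). *)
Lemma cube_volume_log (R : realType) (d : nat) (s L : R) : 1 <= L ->
  1 <= s * Num.sqrt L ->
  (1 + 2 * (s * Num.sqrt L)) ^+ d.+1 * L ^+ d <=
  (3 * s) ^+ d.+1 * L `^ (3 * d.+1%:R / 2 - 1).
Proof.
move=> L1 r1; have L0 : 0 <= L by apply: le_trans L1.
have -> : L `^ (3 * d.+1%:R / 2 - 1) = Num.sqrt L ^+ d.+1 * L ^+ d.
  rewrite -powR12_sqrt// -[_ ^+ d.+1]powR_mulrn ?powR_ge0// -powRrM -[L ^+ d]powR_mulrn//.
  rewrite -powRD; last by apply/implyP => _; rewrite gt_eqF// (lt_le_trans ltr01).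
  by congr (_ `^ _); rewrite -[d.+1%:R]natr1; field.
rewrite [leRHS]mulrA -exprMn ler_wpM2r ?exprn_ge0//.
by apply: lerXn2r; rewrite ?nnegrE; lra.
Qed.

(** The three summands are the discrepancy term, twice the rounding error and the
tail.  Here e3 and e4 are the exponentials with 3 and 4 in the exponent, sL is
the square root of L = ln n, ni is 1 / n, v is (1 + 2 r)^d and l is
L^(d - 1). *)
Lemma rate_sum_le (R : realType) (B D g K C e3 e4 Lam sL s ni v l S : R) :
  0 <= B -> 0 <= D -> 0 <= g -> 0 <= K -> 0 <= s -> 0 <= ni -> 0 <= C -> 0 <= e3 ->
  0 <= v * l -> 0 <= sL -> 1 <= Lam * e4 ->
  C * e3 <= e4 -> e3 <= e4 -> v * l <= S * Lam -> sL <= Lam ->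
  B * e3 * v * (C * (l * ni)) + 2 * (D * (2 * (s * sL) * ni) * (B * e3)) +
    K * ni * (D * g) <=
  (B * S + 4 * D * s * B + K * (D * g)) * (Lam * e4 * ni).
Proof.
move=> B0 D0 g0 K0 s0 ni0 C0 e30 vl0 sL0 Le Ce ee vl sLam.
have H1 : C * e3 * (v * l) <= e4 * (S * Lam) by apply: ler_pM => //; exact: mulr_ge0.
have H2 : sL * e3 <= Lam * e4 by exact: ler_pM.
have c1 : 0 <= B * ni by exact: mulr_ge0.
have c2 : 0 <= 4 * D * s * B * ni.
  by do 4 (apply: mulr_ge0 => //); rewrite ler0n.
have c3 : 0 <= K * (D * g) * ni.
  by apply: mulr_ge0 => //; apply: mulr_ge0 => //; exact: mulr_ge0.
have G1 := ler_wpM2l c1 H1; have G2 := ler_wpM2l c2 H2; have G3 := ler_wpM2l c3 Le.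
have -> : B * e3 * v * (C * (l * ni)) + 2 * (D * (2 * (s * sL) * ni) * (B * e3)) +
    K * ni * (D * g) = B * ni * (C * e3 * (v * l)) +
    4 * D * s * B * ni * (sL * e3) + K * (D * g) * ni * 1 by ring.
have -> : (B * S + 4 * D * s * B + K * (D * g)) * (Lam * e4 * ni) =
  B * ni * (e4 * (S * Lam)) + 4 * D * s * B * ni * (Lam * e4) +
  K * (D * g) * ni * (Lam * e4) by ring.
by apply: lerD => //; exact: lerD.
Qed.

Lemma rate_powR (R : realType) (n L M p q x : R) : 0 <= n ->
  (L `^ p * expR (M * x) / n) `^ q =
  n `^ (- q) * L `^ (q * p) * expR (q * M * x).
Proof.
move=> n0; have ni0 : 0 <= n^-1 by rewrite invr_ge0.
rewrite (powRM q _ ni0) ?mulr_ge0 ?powR_ge0 ?expR_ge0//.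
rewrite (powRM q (powR_ge0 L p) (expR_ge0 _)).
rewrite -(powR_inv1 n0) -!powRrM -expRM mulN1r.
rewrite [p * q]mulrC [M * x * q]mulrC mulrA [LHS]mulrC mulrA //.
Qed.

Lemma moment_rate_le (R : realType) (q A K T c kappa ni : R) :
  0 <= q -> 0 <= A -> A <= kappa * T -> 0 <= kappa -> 0 <= K -> 0 <= ni ->
  ni <= T -> 0 <= c ->
  2 `^ q * (A `^ q + (K * ni) `^ q * c) <=
  (2 `^ q * (kappa `^ q + K `^ q * c) + 1) * T `^ q.
Proof.
move=> q0 A0 AT kappa0 K0 ni0 niT c0; have T0 : 0 <= T by exact: le_trans niT.
rewrite mulrDl mul1r -mulrA -[leLHS]addr0; apply: lerD; last exact: powR_ge0.
apply: ler_wpM2l; first exact: powR_ge0.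
rewrite mulrDl; apply: lerD.
  by rewrite -powRM//; apply: ge0_ler_powR; rewrite ?nnegrE// mulr_ge0.
rewrite mulrAC; apply: ler_wpM2r => //; rewrite -powRM//.
by apply: ge0_ler_powR; rewrite ?nnegrE ?mulr_ge0// ler_wpM2l.
Qed.

Unset Implicit Arguments.
Set Strict Implicit.

Theorem theorem2p2 (R : realType) (d : nat) (q M B k : R)
    (hd : (1 <= d)%N) (hq : 2 <= q) (hM : 0 < M) (hB : 0 < B)
    (hk0 : 0 < k) (hk2 : k < 2) :
  exists K : R, 0 < K /\
  forall C : R, exists N : nat,
  forall (dT : nat -> measure_display) (T : forall n, measurableType (dT n))
    (P : forall n, probability (T n) R)
    (y : forall n, 'I_n -> T n -> 'rV[R]_d)
    (dX : measure_display) (TX : measurableType dX) (PX : probability TX R)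
    (X : TX -> 'rV[R]_d),
  (forall n, (2 <= n)%N -> rqmc_points (P n) C (y n)) ->
  std_normal_vector PX X ->
  forall n, (N <= n)%N ->
  (ereal_sup [set moment_error (P n) (y n) PX X q f | f in growth_class M B k]
   <= (K * (n%:R `^ (- q) * ln n%:R `^ (q * (3 * d%:R / 2 - 1))
            * expR (q * M * (4 * q * d%:R * ln n%:R) `^ (k / 2))))%:E)%E.
Proof.
case: d hd => [//|d] _.
have [D DE] : exists D : R, d.+1%:R = D by eexists.
rewrite DE.
have q0 : 0 < q by lra.
have q1 : 1 <= q by lra.
have D1 : 1 <= D by rewrite -DE ler1n.
have D0 : 0 <= D by lra.
have B0 := ltW hB.
have [K1 K10 tail] := @growth_tail R d q M B k q0 hM hB hk0 hk2.
have K1_ge0 := ltW K10.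
have [g [gE g0]] : exists g : R, g = gauss_moment_const /\ 0 <= g.
  by exists gauss_moment_const; split => //; exact: gauss_moment_const_ge0.
have [s [sE s0]] : exists s : R, s = Num.sqrt (3 * q) /\ 0 <= s.
  by exists (Num.sqrt (3 * q)); rewrite sqrtr_ge0.
have [kappa kappaE] : exists kappa : R, kappa =
    B * (3 * s) ^+ d.+1 + 4 * D * s * B + K1 * (D * g) by eexists.
have kappa0 : 0 <= kappa.
  have s30 : 0 <= (3 * s) ^+ d.+1 by rewrite exprn_ge0 ?mulr_ge0.
  have D40 : 0 <= 4 * D by rewrite mulr_ge0.
  rewrite kappaE; apply: addr_ge0; last by apply: mulr_ge0 => //; exact: mulr_ge0.
  apply: addr_ge0; first exact: mulr_ge0.
  by apply: mulr_ge0 => //; exact: mulr_ge0.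
have Dg0 : 0 <= D `^ q * g by apply: mulr_ge0 => //; exact: powR_ge0.
exists (2 `^ q * (kappa `^ q + K1 `^ q * (D `^ q * g)) + 1); split.
  apply: ltr_wpDl => //; apply: mulr_ge0; first exact: powR_ge0.
  by apply: addr_ge0; [|apply: mulr_ge0 => //]; exact: powR_ge0.
move=> C0; have [C [C0C C1]] : exists C : R, C0 <= C /\ 1 <= C.
  by exists (Num.max C0 1); rewrite !le_max !lexx orbT.
have C_ge0 : 0 <= C by lra.
have k20 : 0 < k / 2 by rewrite divr_gt0.
have qD1 : 1 <= q * D by exact: mulr_ege1.
have [L0 L01 slack] := exponential_slack hM k20 qD1 C_ge0.
(* The second bound ensures ln n >= L0. *)
exists (maxn 2 (Num.truncn (expR L0)).+1) => dT T P y dX TX PX X Hy HX n.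
rewrite geq_max => /andP[n2 nL].
have n0 : (0 < n)%N by apply: leq_trans n2.
have nR0 : 0 < n%:R :> R by rewrite ltr0n.
have ni0 : 0 <= n%:R^-1 :> R by rewrite invr_ge0.
have [L LE] : exists L : R, L = ln n%:R by eexists.
have LL0 : L0 <= L.
  rewrite LE -[L0]expRK ler_ln ?posrE ?expR_gt0//.
  by apply: ltW; apply: lt_le_trans (Num.Theory.truncnS_gt _) _; rewrite ler_nat.
have L1 : 1 <= L by exact: le_trans L01 LL0.
have L_ge0 : 0 <= L by lra.
have [r [rE r2 rS]] : exists r : R,
    [/\ r = s * Num.sqrt L, r ^+ 2 = 3 * q * L & r = Num.sqrt (3 * q * L)].
  have q30 : 0 <= 3 * q by lra.
  exists (s * Num.sqrt L); rewrite sE -sqrtrM//; split => //.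
  by rewrite sqr_sqrtr// mulr_ge0.
have r0 : 0 <= r by rewrite rS sqrtr_ge0.
have r1 : 1 <= r.
  by rewrite -(@ler_pXn2r _ 2)// ?nnegrE// expr1n r2; nra.
have [e4 e4E] : exists e : R, e = expR (M * (4 * q * D * L) `^ (k / 2)) by eexists.
have [e3 e3E] : exists e : R, e = expR (M * (3 * (q * D) * L) `^ (k / 2)) by eexists.
have [Lam LamE] : exists x : R, x = L `^ (3 * D / 2 - 1) by eexists.
have e30 : 0 <= e3 by rewrite e3E expR_ge0.
have Ce : C * e3 <= e4.
  by have := slack L LL0; rewrite -e3E [4 * (q * _)]mulrA -e4E.
have ee : e3 <= e4 by apply: le_trans Ce; rewrite ler_peMl.
have growE : cube_growth d.+1 M B k r = B * e3.
  rewrite rS e3E; apply: cube_growth_sqrt; first by rewrite -r2 sqr_ge0.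
  by rewrite DE; ring.
have e41 : 1 <= e4.
  by rewrite e4E -expR0 ler_expR mulr_ge0 ?powR_ge0// ltW.
have p0 : 0 <= 3 * D / 2 - 1 by clear -D1; lra.
have p2 : 2^-1 <= 3 * D / 2 - 1 by clear -D1; lra.
have Lam1 : 1 <= Lam by have := ler_powR L1 p0; rewrite powRr0 -LamE.
have sqL : Num.sqrt L <= Lam.
  by have := ler_powR L1 p2; rewrite powR12_sqrt// -LamE.
have vol : (1 + 2 * r) ^+ d.+1 * L ^+ d <= (3 * s) ^+ d.+1 * Lam.
  by rewrite rE LamE -DE; apply: cube_volume_log => //; rewrite -rE.
rewrite -LE (_ : n%:R `^ (- q) * _ * _ = (Lam * e4 / n%:R) `^ q); last first.
  by rewrite LamE e4E rate_powR// ltW.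
have tailE : expR (- r ^+ 2 / (3 * q)) = n%:R^-1.
  rewrite r2 mulNr mulrAC divff; last by rewrite gt_eqF// mulr_gt0.
  by rewrite mul1r expRN LE lnK// posrE.
clear e3E e4E LamE slack.
have Le4 : 1 <= Lam * e4 by exact: mulr_ege1.
have niT : n%:R^-1 <= Lam * e4 / n%:R by rewrite ler_peMl.
have b10 : 0 <= D * (2 * r / n%:R) * (B * e3).
  by rewrite mulr_ge0 ?mulr_ge0.
have b20 : 0 <= K1 / n%:R by rewrite mulr_ge0.
apply: ub_ereal_sup => _ [f fG <-].
have [fK fGb] := tail f fG.
have Cy := rqmc_points_le n0 C0C (Hy n n2).
have fGb' x : `|f x - f (grid_round r n (enum 'I_d.+1) x)| <=
    D * (2 * r / n%:R) * (B * e3) + K1 / n%:R * gauss_weight q x.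
  by have := fGb r n x r0 n0; rewrite tailE growE DE.
have := moment_error_le n0 q1 hM hB hk0 r0 n0 fG K1_ge0 b10 b20 C_ge0 fK fGb' Cy HX.
rewrite growE DE -gE -LE /=.
move=> /le_trans; apply; rewrite lee_fin.
have v0 : 0 <= (1 + 2 * r) ^+ d.+1 by rewrite exprn_ge0// addr_ge0// mulr_ge0.
have l0 : 0 <= L ^+ d by exact: exprn_ge0.
apply: moment_rate_le => //; first exact: ltW.
  apply: addr_ge0; last by apply: mulr_ge0 => //; exact: mulr_ge0.
  apply: addr_ge0; last by apply: mulr_ge0.
  apply: mulr_ge0; first by apply: mulr_ge0 => //; exact: mulr_ge0.
  by apply: mulr_ge0 => //; exact: mulr_ge0.
rewrite kappaE {2}rE; apply: rate_sum_le => //; first exact: mulr_ge0.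
Qed.
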